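(* Let $(M,g)$ be a pseudo-Riemannian manifold with Levi-Civita connection $\nabla^g$, whose Ricci tensor $\mathrm{Ric}$ is non-degenerate (hence a pseudo-Riemannian metric), and let $\mathrm{scal}$ be its scalar curvature. Let $f,\lambda$ be smooth functions on $M$ such that $(g,f,\lambda)$ defines a gradient almost Einstein soliton, i.e. $\mathrm{Hess}(f)+\mathrm{Ric}=\left(\lambda+\frac{\mathrm{scal}}{2}\right)g$. Then $(\mathrm{Ric},\nabla^g)$ is a statistical structure on $M$ if and only if $$g(R^{\nabla^g}(X,Y)\nabla f,Z)=X\left(\lambda+\frac{\mathrm{scal}}{2}\right)g(Y,Z)-Y\left(\lambda+\frac{\mathrm{scal}}{2}\right)g(X,Z)$$ for all $X,Y,Z\in\mathfrak{X}(M)$.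
   Context: A statistical structure on a smooth manifold $M$ is a pair $(h,\nabla)$ where $h$ is a pseudo-Riemannian metric, $\nabla$ is a torsion-free affine connection, and $(\nabla_X h)(Y,Z)=(\nabla_Y h)(X,Z)$ for all $X,Y,Z\in\mathfrak{X}(M)$. $\nabla f$ is the $g$-gradient of $f$, $\mathrm{Hess}(f)(X,Y)=g(\nabla^g_X\nabla f,Y)$, and $R^{\nabla^g}(X,Y)=\nabla^g_X\nabla^g_Y-\nabla^g_Y\nabla^g_X-\nabla^g_{[X,Y]}$. *)

(* Defs.v *)
From HB Require Import structures.
From mathcomp Require Import all_boot all_order all_algebra.
From mathcomp Require Import all_classical all_reals all_analysis.

Set Implicit Arguments.
Unset Strict Implicit.
Unset Printing Implicit Defensive.

Import Order.TTheory GRing.Theory Num.Theory.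
Import numFieldNormedType.Exports.

Local Open Scope classical_set_scope.
Local Open Scope ring_scope.

(** * Smooth functions on open subsets of R^n *)

(* Only meant for open U: then the partial derivatives at points of U depend
   only on the values of F on U. *)
Fixpoint Ck_on (R : realType) (n k : nat) (U : set 'rV[R]_n)
    (F : 'rV[R]_n -> R) : Prop :=
  {in U, continuous F} /\
  if k is k'.+1 then
    forall i : 'I_n,
      (forall x, U x -> derivable F x (delta_mx 0 i)) /\
      Ck_on k' U (fun x => 'D_(delta_mx 0 i) F x)
  else True.

Definition smooth_on (R : realType) (n : nat) (U : set 'rV[R]_n)
    (F : 'rV[R]_n -> R) : Prop :=
  forall k, Ck_on k U F.

(** * Smooth manifolds *)

(* [chart_map] is only relevant on [dom], [chart_inv] only on its image. *)
Record chart (R : realType) (n : nat) (T : topologicalType) := Chart {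
  dom : set T;
  chart_map : T -> 'rV[R]_n;
  chart_inv : 'rV[R]_n -> T;
  dom_open : open dom;
  img_open : open (chart_map @` dom);
  chart_mapK : {in dom, cancel chart_map chart_inv};
  chart_map_continuous : {within dom, continuous chart_map};
  chart_inv_continuous : {within chart_map @` dom, continuous chart_inv}
}.

Definition compatible (R : realType) (n : nat) (T : topologicalType)
    (c d : chart R n T) : Prop :=
  forall j : 'I_n,
    smooth_on (chart_map c @` (dom c `&` dom d))
              (fun x => chart_map d (chart_inv c x) 0 j).

Record manifold (R : realType) (n : nat) := Manifold {
  space :> topologicalType;
  atlas : set (chart R n space);
  space_hausdorff : hausdorff_space space;
  space_second_countable : @second_countable space;
  atlas_cover : forall p, exists2 c, atlas c & dom c p;
  atlas_compatible : forall c d, atlas c -> atlas d -> compatible c d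
}.

Definition smooth (R : realType) (n : nat) (M : manifold R n) (u : M -> R) :
    Prop :=
  forall c, atlas c ->
    smooth_on (chart_map c @` dom c) (fun x => u (chart_inv c x)).

(** * Tangent vectors and vector fields *)

(* A tangent vector is identified with its action on smooth functions: T_p M is
   spanned by the coordinate derivatives at p. Operators are made to vanish on
   non-smooth functions, so that Leibniz equality of operators is equality of
   tangent vectors. *)
Definition chart_vector (R : realType) (n : nat) (M : manifold R n)
    (c : chart R n M) (p : M) (a : 'rV[R]_n) : (M -> R) -> R^o :=
  fun u => if `[< smooth u >]
           then 'D_a (fun x => u (chart_inv c x)) (chart_map c p) else 0.

Definition tangent (R : realType) (n : nat) (M : manifold R n) (p : M) :
    set ((M -> R) -> R^o) :=
  [set v | exists c a, [/\ atlas c, dom c p & v = chart_vector c p a]].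

(* The elements of X(M) are the raw fields satisfying [vfield] below; operators
   defined on raw fields (metrics, connections) are only constrained, and only
   evaluated, on elements of X(M). *)
Definition rawfield (R : realType) (n : nat) (M : manifold R n) : Type :=
  M -> (M -> R) -> R^o.

Definition rawconnection (R : realType) (n : nat) (M : manifold R n) : Type :=
  rawfield M -> rawfield M -> rawfield M.

Definition rawtensor2 (R : realType) (n : nat) (M : manifold R n) : Type :=
  rawfield M -> rawfield M -> M -> R.

Definition lie (R : realType) (n : nat) (M : manifold R n)
    (X : rawfield M) (u : M -> R) : M -> R :=
  fun p => X p u.

Definition vfield (R : realType) (n : nat) (M : manifold R n)
    (X : rawfield M) : Prop :=
  (forall p, tangent p (X p)) /\ (forall u, smooth u -> smooth (lie X u)).

Definition fscale (R : realType) (n : nat) (M : manifold R n)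
    (u : M -> R) (X : rawfield M) : rawfield M :=
  fun p => u p *: X p.

Definition bracket (R : realType) (n : nat) (M : manifold R n)
    (X Y : rawfield M) : rawfield M :=
  fun p u => X p (lie Y u) - Y p (lie X u).

(* Vector fields on M whose values at p form a basis of T_p M. *)
Definition frame_at (R : realType) (n : nat) (M : manifold R n) (p : M)
    (E : 'I_n -> rawfield M) : Prop :=
  (forall i, vfield (E i)) /\
  (forall v, tangent p v ->
     exists! a : 'rV[R]_n, v = \sum_i a 0 i *: E i p).

(* Trace on T_p M of the endomorphism induced by a C^oo(M)-linear operator A of
   X(M), computed in any frame; it does not depend on the frame. *)
Definition trace_at (R : realType) (n : nat) (M : manifold R n)
    (A : rawfield M -> rawfield M) (p : M) : R :=
  xget 0 [set t | exists E a,
    [/\ frame_at p E,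
        forall j, A (E j) p = \sum_i (a : 'M[R]_n) i j *: E i p &
        t = \tr a]].

(** * Covariant 2-tensors and pseudo-Riemannian metrics *)

(* (0,2)-tensor fields as C^oo(M)-bilinear maps X(M) x X(M) -> C^oo(M). *)
Definition tensor2 (R : realType) (n : nat) (M : manifold R n)
    (h : rawtensor2 M) : Prop :=
  [/\ forall X Y, vfield X -> vfield Y -> smooth (h X Y),
      forall u X X' Y, smooth u -> vfield X -> vfield X' -> vfield Y ->
        forall p, h (fscale u X + X') Y p = u p * h X Y p + h X' Y p &
      forall u X Y Y', smooth u -> vfield X -> vfield Y -> vfield Y' ->
        forall p, h X (fscale u Y + Y') p = u p * h X Y p + h X Y' p].

Definition symmetric2 (R : realType) (n : nat) (M : manifold R n)
    (h : rawtensor2 M) : Prop :=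
  forall X Y, vfield X -> vfield Y -> forall p, h X Y p = h Y X p.

Definition nondegenerate2 (R : realType) (n : nat) (M : manifold R n)
    (h : rawtensor2 M) : Prop :=
  forall p X, vfield X -> (forall Y, vfield Y -> h X Y p = 0) -> X p = 0.

Definition pseudo_riemannian (R : realType) (n : nat) (M : manifold R n)
    (h : rawtensor2 M) : Prop :=
  [/\ tensor2 h, symmetric2 h & nondegenerate2 h].

(* The contraction g^{ij} h_{ij}, which does not depend on the frame. *)
Definition metric_trace (R : realType) (n : nat) (M : manifold R n)
    (g h : rawtensor2 M) (p : M) : R :=
  xget 0 [set t | exists2 E, frame_at p E &
    t = \tr (invmx (\matrix_(i, j) g (E i) (E j) p)
             *m \matrix_(i, j) h (E i) (E j) p)].

Definition grad (R : realType) (n : nat) (M : manifold R n)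
    (g : rawtensor2 M) (f : M -> R) : rawfield M :=
  xget (0 : M -> (M -> R) -> R^o)
    [set G | vfield G /\ forall X, vfield X -> forall p, g G X p = lie X f p].

(** * Affine connections and curvature *)

Definition affine_connection (R : realType) (n : nat) (M : manifold R n)
    (nabla : rawconnection M) : Prop :=
  [/\ forall X Y, vfield X -> vfield Y -> vfield (nabla X Y),
      forall u X X' Y, smooth u -> vfield X -> vfield X' -> vfield Y ->
        nabla (fscale u X + X') Y = fscale u (nabla X Y) + nabla X' Y,
      forall X Y Y', vfield X -> vfield Y -> vfield Y' ->
        nabla X (Y + Y') = nabla X Y + nabla X Y' &
      forall u X Y, smooth u -> vfield X -> vfield Y ->
        nabla X (fscale u Y) = fscale (lie X u) Y + fscale u (nabla X Y)].

Definition torsion_free (R : realType) (n : nat) (M : manifold R n)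
    (nabla : rawconnection M) : Prop :=
  forall X Y, vfield X -> vfield Y -> nabla X Y - nabla Y X = bracket X Y.

(* (nabla_X h)(Y, Z) *)
Definition covder (R : realType) (n : nat) (M : manifold R n)
    (nabla : rawconnection M) (h : rawtensor2 M) (X Y Z : rawfield M) :
    M -> R :=
  fun p => lie X (h Y Z) p - h (nabla X Y) Z p - h Y (nabla X Z) p.

Definition levi_civita (R : realType) (n : nat) (M : manifold R n)
    (g : rawtensor2 M) (nabla : rawconnection M) : Prop :=
  [/\ affine_connection nabla, torsion_free nabla &
      forall X Y Z, vfield X -> vfield Y -> vfield Z ->
        forall p, covder nabla g X Y Z p = 0].

Definition curvature (R : realType) (n : nat) (M : manifold R n)
    (nabla : rawconnection M) (X Y Z : rawfield M) : rawfield M :=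
  nabla X (nabla Y Z) - nabla Y (nabla X Z) - nabla (bracket X Y) Z.

(* Ric(Y, Z) = tr (X |-> R(X, Y) Z) *)
Definition ricci (R : realType) (n : nat) (M : manifold R n)
    (nabla : rawconnection M) : rawtensor2 M :=
  fun Y Z => trace_at (fun X => curvature nabla X Y Z).

Definition scal (R : realType) (n : nat) (M : manifold R n)
    (g : rawtensor2 M) (nabla : rawconnection M) : M -> R :=
  metric_trace g (ricci nabla).

Definition hess (R : realType) (n : nat) (M : manifold R n)
    (g : rawtensor2 M) (nabla : rawconnection M) (f : M -> R) :
    rawtensor2 M :=
  fun X Y => g (nabla X (grad g f)) Y.

(** * Einstein solitons and statistical structures *)

Definition gradient_almost_einstein_soliton (R : realType) (n : nat)
    (M : manifold R n) (g : rawtensor2 M) (nabla : rawconnection M)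
    (f lam : M -> R) : Prop :=
  forall X Y, vfield X -> vfield Y -> forall p,
    hess g nabla f X Y p + ricci nabla X Y p =
    (lam p + scal g nabla p / 2) * g X Y p.

Definition statistical_structure (R : realType) (n : nat) (M : manifold R n)
    (h : rawtensor2 M) (nabla : rawconnection M) : Prop :=
  [/\ pseudo_riemannian h, affine_connection nabla, torsion_free nabla &
      forall X Y Z, vfield X -> vfield Y -> vfield Z ->
        forall p, covder nabla h X Y Z p = covder nabla h Y X Z p].

(* Main.v *)
Require Import Defs.
From HB Require Import structures.
From mathcomp Require Import all_boot all_order all_algebra.
From mathcomp Require Import all_classical all_reals all_analysis.
From mathcomp Require Import ring lra.

Import Order.TTheory GRing.Theory Num.Theory.
Import numFieldNormedType.Exports.
Local Open Scope classical_set_scope.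
Local Open Scope ring_scope.

Set Implicit Arguments.
Unset Strict Implicit.
Unset Printing Implicit Defensive.

(* With mu = lam + scal / 2 the soliton equation reads
     Ric(Y, Z) = mu g(Y, Z) - g(nabla_Y grad f, Z).
   Differentiating it along X and using that nabla is metric and torsion-free,
     (nabla_X Ric)(Y, Z) - (nabla_Y Ric)(X, Z)
       = X(mu) g(Y, Z) - Y(mu) g(X, Z) - g(R(X, Y) grad f, Z),
   so the Codazzi equation for Ric is the asserted curvature identity. The
   soliton equation also makes Ric bilinear and, the Hessian being symmetric,
   symmetric. What remains is smoothness: Ric(Y, Z) is computed as a trace in a
   smooth local frame, and mu is then a quotient of smooth functions near any
   point where g(X, Y) <> 0. The local frames consist of global vector fields,
   namely coordinate fields multiplied by bump functions. *)

(** * Functions of several variables *)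

(** Metrics and connections act on global vector fields only: they cannot be restricted to an open
    set, and the value of A(X) at p is not a priori a function of X(p). Every local argument is
    therefore phrased through identities valid on all of M. A frame [E] comes with functions [w] and
    the matrix B = (E_i(w_j)); Cramer's rule expresses det(B) v through the E_i and the adjugate of
    B, without division. Applied to fields, this identity makes every C^oo-linear operator
    pointwise. Pointwise dependence in turn shows that [trace_at], which selects some frame by
    choice, has the same value in all frames, and so equals det(B)^-1 tr(L adj(B)) near p, with L =
    ((A E_i)(w_j)). Only sums, products and one inverse of smooth functions occur there, which is
    why the calculus below is developed for germs and for exactly these operations, together with
    composition, needed for changes of charts and for bump functions. *)

Lemma coord_le_norm (R : realType) (n : nat) (x : 'rV[R]_n) (i : 'I_n) :
  `|x 0 i| <= `|x|.
Proof.
rewrite [leRHS]/Num.Def.normr/= mx_normrE.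
exact: (le_bigmax _ (fun ij : 'I_1 * 'I_n => `|x ij.1 ij.2|) (0, i)).
Qed.

Lemma norm_le_coord (R : realType) (n : nat) (x : 'rV[R]_n) (e : R) :
  0 <= e -> (forall i, `|x 0 i| <= e) -> `|x| <= e.
Proof.
move=> e0 xe; rewrite [leLHS]/Num.Def.normr/= mx_normrE.
by rewrite (bigmax_le _ e0)// => -[i j] _ /=; rewrite (ord1 i).
Qed.

Lemma is_derive_line (R : realType) (V W : normedModType R) (F : V -> W)
    (y v : V) (s : R) :
  derivable F (y + s *: v) v ->
  is_derive s (1 : R) (fun t : R => F (y + t *: v)) ('D_v F (y + s *: v)).
Proof.
have E : (fun h : R => h^-1 *: (((fun t : R => F (y + t *: v)) \o shift s) (h *: 1)
    - F (y + s *: v))) =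
    (fun h => h^-1 *: ((F \o shift (y + s *: v)) (h *: v) - F (y + s *: v))).
  rewrite funeqE => h /=; congr (_ *: (F _ - _)).
  by rewrite -[h *: 1]/(h * 1) mulr1 scalerDl addrCA.
by move=> dF; split; rewrite /derivable /derive E.
Qed.

Lemma mean_value_line (R : realType) (V : normedModType R) (F : V -> R)
    (y v : V) (t d e : R) :
  (forall s, `|s| <= `|t| -> derivable F (y + s *: v) v) ->
  (forall s, `|s| <= `|t| -> `|'D_v F (y + s *: v) - d| <= e) ->
  `|F (y + t *: v) - F y - t * d| <= e * `|t|.
Proof.
move=> dF bF.
(* The mean value theorem needs an ordered segment, while t has either sign; [main] is used on
   [0, t] or on [t, 0]. *)
have main a b : a <= b -> (forall s, s \in `[a, b] -> `|s| <= `|t|) ->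
    `|F (y + b *: v) - F (y + a *: v) - (b - a) * d| <= e * (b - a).
  move=> ab st.
  have [||c cab ->] := @MVT_segment R (fun s => F (y + s *: v))
      (fun s => 'D_v F (y + s *: v)) a b ab.
  - move=> s sab; apply/is_derive_line/dF/st.
    by rewrite in_itv /= !ltW ?(itvP sab).
  - apply: derivable_within_continuous => s sab.
    by have [] := is_derive_line (dF _ (st _ sab)).
  rewrite [(b - a) * d]mulrC -mulrBl normrM [`|b - a|]ger0_norm ?subr_ge0//.
  by rewrite ler_wpM2r ?subr_ge0// bF// st.
have [t0|t0] := leP 0 t.
- have := main 0 t t0; rewrite scale0r addr0 subr0 [`|t|]ger0_norm//; apply.
  by move=> s /andP[s0 st]; rewrite !bnd_simp in s0 st; rewrite ger0_norm.
- have := main t 0 (ltW t0); rewrite scale0r addr0 sub0r [`|t|]ltr0_norm//.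
  rewrite -normrN (_ : - (F y - _ - _) = F (y + t *: v) - F y - t * d); last by ring.
  apply.
  move=> s /andP[ts s0]; rewrite !bnd_simp in s0 ts.
  by rewrite ler0_norm// lerN2.
Qed.

(** Corners of the staircase from 0 (k = 0) to h (k = n) whose steps are parallel to the coordinate
    axes. *)
Definition trunc_row (R : realType) (n : nat) (h : 'rV[R]_n) (k : nat) : 'rV[R]_n :=
  \row_i (if (i < k)%N then h 0 i else 0).

Lemma trunc_rowS (R : realType) (n : nat) (h : 'rV[R]_n) (i : 'I_n) :
  trunc_row h i.+1 = trunc_row h i + h 0 i *: delta_mx 0 i.
Proof.
apply/rowP => j; rewrite !mxE eqxx /= ltnS leq_eqVlt.
have [->|ji] := eqVneq j i; first by rewrite eqxx ltnn add0r mulr1.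
by rewrite mulr0 addr0 (negbTE (ji : val j != val i)).
Qed.

Lemma linear_coord_sum (R : realType) (n : nat) (a : 'I_n -> R) :
  linear (fun h : 'rV[R]_n => \sum_i h 0 i * a i : R).
Proof.
move=> k u v; rewrite scaler_sumr -big_split /=; apply: eq_bigr => i _.
by rewrite !mxE mulrDl -mulrA.
Qed.

Lemma continuous_coord_sum (R : realType) (n : nat) (a : 'I_n -> R) :
  continuous (fun h : 'rV[R]_n => \sum_i h 0 i * a i).
Proof.
apply: continuous_big => [|i _ h]; first exact: add_continuous.
apply: (@cvgMr_tmp R); first exact: (nbhs_filter h).
exact: (@coord_continuous R 1 n 0 i h).
Qed.

(* The increment is telescoped over the coordinates and the mean value theorem
   is applied to each step. *)
Lemma differentiable_C1 (R : realType) (n : nat) (F : 'rV[R]_n -> R)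
    (x : 'rV[R]_n) :
  (forall i, \forall y \near x, derivable F y (delta_mx 0 i)) ->
  (forall i, {for x, continuous (fun y => 'D_(delta_mx 0 i) F y)}) ->
  differentiable F x.
Proof.
move=> dF cF; pose a i := 'D_(delta_mx 0 i) F x.
pose L : {linear 'rV[R]_n -> R} :=
  HB.pack (fun h : 'rV[R]_n => \sum_i h 0 i * a i : R)
    (GRing.isLinear.Build _ _ _ _ _ (linear_coord_sum a)).
have cL : continuous L := @continuous_coord_sum R n a.
suff E : F \o shift x = cst (F x) + L +o_ (0 : 'rV[R]_n) id.
  by apply/diff_locallyP; rewrite (diff_unique cL E).
apply/eqaddoP => _/posnumP[e].
(* Each of the n steps costs at most e' |h|, and n e' <= e; dividing by n + 1 also covers n = 0. *)
pose e' := e%:num / n.+1%:R.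
have e'0 : 0 < e' by rewrite divr_gt0.
have : \forall y \near x, forall i, derivable F y (delta_mx 0 i) /\
    `|'D_(delta_mx 0 i) F y - a i| <= e'.
  apply: (filter_forall (F := nbhs x)) => i; apply: filterI; first exact: dF.
  have /cvgrPdist_le /(_ _ e'0) := cF i.
  by apply: filterS => y; rewrite distrC.
move=> /nbhs_ballP[r /= r0 Hr]; apply/nbhs_ballP; exists r => //= h.
rewrite -ball_normE /= sub0r normrN => hr.
have step (i : 'I_n) : `|F (x + trunc_row h i.+1) - F (x + trunc_row h i) -
    h 0 i * a i| <= e' * `|h|.
  rewrite trunc_rowS addrA.
  (* The norm is the maximum norm, so points of the staircase, whose coordinates are dominated by
     those of h, stay in the ball. *)
  have inb s : `|s| <= `|h 0 i| ->
      ball x r (x + trunc_row h i + s *: delta_mx 0 i).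
    move=> sh; rewrite -ball_normE /= -addrA opprD addNKr normrN.
    apply: le_lt_trans hr; apply: norm_le_coord => // j.
    rewrite !mxE eqxx /=; have [->|ji] := eqVneq j i.
      by rewrite ltnn add0r mulr1 (le_trans sh)// coord_le_norm.
    by rewrite mulr0 addr0; case: ifP => _; rewrite ?normr0// coord_le_norm.
  apply: le_trans (_ : e' * `|h 0 i| <= _).
    apply: mean_value_line => s /inb /Hr; first by move=> /(_ i)[].
    by move=> /(_ i)[].
  by rewrite ler_wpM2l ?(ltW e'0)// coord_le_norm.
have tele : F (x + h) - F x =
    \sum_(i < n) (F (x + trunc_row h i.+1) - F (x + trunc_row h i)).
  rewrite -(big_mkord xpredT
    (fun i => F (x + trunc_row h i.+1) - F (x + trunc_row h i))).
  rewrite telescope_sumr//; congr (F _ - F _).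
    by congr (_ + _); apply/rowP => i; rewrite !mxE ltn_ord.
  by rewrite -[LHS]addr0; congr (_ + _); apply/rowP => i; rewrite !mxE.
rewrite [`|_ - _|](_ : _ = `|F (x + h) - F x - \sum_i h 0 i * a i|); last first.
  congr (`| _ |); rewrite -[LHS]/(F (h + x) - (F x + \sum_i h 0 i * a i)).
  by rewrite [h + x]addrC opprD addrA.
rewrite tele -sumrB (le_trans (ler_norm_sum _ _ _))//.
rewrite (le_trans (ler_sum _ (fun i _ => step i)))//.
rewrite sumr_const card_ord -[_ *+ n]mulr_natl mulrA ler_wpM2r//.
rewrite /e' mulrC -mulrA ler_piMr// mulrC ler_pdivrMr// mul1r.
by rewrite ler_nat.
Qed.

(** * Calculus of germs of C^k functions *)

Section SmoothGerms.
Variable R : realType.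
Implicit Types n m k : nat.

(** The pointwise counterpart of [Ck_on]. It depends only on the germ of F at x, so a function may
    be replaced by a locally equal one without shrinking domains. *)
Fixpoint Ck_near n k (F : 'rV[R]_n -> R) (x : 'rV[R]_n) : Prop :=
  (\forall y \near x, {for y, continuous F}) /\
  if k is k'.+1 then
    forall i : 'I_n, (\forall y \near x, derivable F y (delta_mx 0 i)) /\
      Ck_near k' (fun y => 'D_(delta_mx 0 i) F y) x
  else True.

Definition Cinf_near n (F : 'rV[R]_n -> R) (x : 'rV[R]_n) :=
  forall k, Ck_near k F x.

Lemma Ck_near_cont n k (F : 'rV[R]_n -> R) x :
  Ck_near k F x -> \forall y \near x, {for y, continuous F}.
Proof. by case: k => [|k] []. Qed.

Lemma Ck_nearS n k (F : 'rV[R]_n -> R) x : Ck_near k.+1 F x -> Ck_near k F x.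
Proof.
elim: k F => [|k IH] F [cF dF]; split=> // i.
by have [? ?] := dF i; split=> //; apply: IH.
Qed.

Lemma near_eq_continuous_at (T U : topologicalType) (f g : T -> U) (y : T) :
  (\forall z \near y, f z = g z) -> {for y, continuous f} ->
  {for y, continuous g}.
Proof.
rewrite /prop_for /continuous_at => fg cf; rewrite -(nbhs_singleton fg).
by apply: cvg_trans cf; apply: near_eq_cvg; apply: filterS fg.
Qed.

(** Functions equal near x are equal near every y close to x ([near_join]), hence so are their
    partial derivatives, and the induction applies to these. *)
Lemma Ck_near_eq n k (F G : 'rV[R]_n -> R) x :
  (\forall y \near x, F y = G y) -> Ck_near k F x -> Ck_near k G x.
Proof.
elim: k F G => [|k IH] F G FG [cF dF]; have FG2 := near_join FG.
all: have cG : \forall y \near x, {for y, continuous G}.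
1,3: by apply: filterS2 cF FG2 => y cFy FGy; exact: near_eq_continuous_at FGy cFy.
  by split.
split=> // i; have [dFi kFi] := dF i; split.
  by apply: filterS2 FG2 dFi => y; exact: near_eq_derivable.
by apply: IH kFi; apply: filterS FG2 => y; exact: near_eq_derive.
Qed.

Lemma Ck_near_ext n k (F G : 'rV[R]_n -> R) x :
  F =1 G -> Ck_near k F x -> Ck_near k G x.
Proof. by move=> FG; apply: Ck_near_eq; apply: filterE. Qed.

Lemma Ck_near_differentiable n k (F : 'rV[R]_n -> R) x :
  Ck_near k.+1 F x -> \forall y \near x, differentiable F y.
Proof.
move=> [_ dF].
have : \forall y \near x, forall i,
    (\forall z \near y, derivable F z (delta_mx 0 i)) /\
    {for y, continuous (fun z => 'D_(delta_mx 0 i) F z)}.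
  apply: (filter_forall (F := nbhs x)) => i.
  by have [/near_join ? /Ck_near_cont ?] := dF i; apply: filterI.
by apply: filterS => y dFy; apply: differentiable_C1 => i; case: (dFy i).
Qed.

Lemma Cinf_near_differentiable n (F : 'rV[R]_n -> R) x :
  Cinf_near F x -> differentiable F x.
Proof. by move=> /(_ 1%N) /Ck_near_differentiable /nbhs_singleton. Qed.

Lemma Ck_near_cst n k (c : R) (x : 'rV[R]_n) : Ck_near k (fun _ => c) x.
Proof.
elim: k c => [|k IH] c; split.
- by apply: filterE => y; exact: (@cst_continuous _ _ c y).
- by [].
- by apply: filterE => y; exact: (@cst_continuous _ _ c y).
- move=> i; split; first by apply: filterE => y; exact: (@derivable_cst R _ _ c y).
  suff -> : (fun y => 'D_(delta_mx 0 i) (fun=> c) y) = (fun=> 0) :> ('rV[R]_n -> R).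
    exact: IH.
  by rewrite funeqE => y; exact: (@derive_cst R _ _ c y).
Qed.

Lemma Ck_nearD n k (F G : 'rV[R]_n -> R) x :
  Ck_near k F x -> Ck_near k G x -> Ck_near k (fun y => F y + G y) x.
Proof.
elim: k F G => [|k IH] F G [cF dF] [cG dG].
all: split; first by apply: filterS2 cF cG => y; exact: continuousD.
  by [].
move=> i; have [dFi kFi] := dF i; have [dGi kGi] := dG i; split.
  by apply: filterS2 dFi dGi => y; exact: derivableD.
apply: Ck_near_eq (IH _ _ kFi kGi).
by apply: filterS2 dFi dGi => y dFy dGy; exact/esym/deriveD.
Qed.

Lemma derive_mul_fun n (F G : 'rV[R]_n -> R) (x v : 'rV[R]_n) :
  derivable F x v -> derivable G x v ->
  F x * 'D_v G x + G x * 'D_v F x = 'D_v (fun y => F y * G y) x.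
Proof. by move=> dF dG; rewrite (deriveM dF dG). Qed.

Lemma Ck_nearM n k (F G : 'rV[R]_n -> R) x :
  Ck_near k F x -> Ck_near k G x -> Ck_near k (fun y => F y * G y) x.
Proof.
elim: k F G => [|k IH] F G kF kG; have [cF dF] := kF; have [cG dG] := kG.
all: split; first by apply: filterS2 cF cG => y; exact: continuousM.
  by [].
move=> i; have [dFi kFi] := dF i; have [dGi kGi] := dG i; split.
  by apply: filterS2 dFi dGi => y; exact: derivableM.
apply: Ck_near_eq (Ck_nearD (IH _ _ (Ck_nearS kF) kGi) (IH _ _ (Ck_nearS kG) kFi)).
by apply: filterS2 dFi dGi => y; exact: derive_mul_fun.
Qed.

Lemma Ck_near_sum n k (I : Type) (r : seq I) (P : pred I)
    (F : I -> 'rV[R]_n -> R) x :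
  (forall i, P i -> Ck_near k (F i) x) ->
  Ck_near k (fun y => \sum_(i <- r | P i) F i y) x.
Proof.
move=> kF; elim: r => [|j r IH].
  by apply: Ck_near_ext (Ck_near_cst _ 0 _) => y; rewrite big_nil.
have [Pj|Pj] := boolP (P j); last first.
  by apply: Ck_near_ext IH => y; rewrite big_cons (negbTE Pj).
by apply: Ck_near_ext (Ck_nearD (kF _ Pj) IH) => y; rewrite big_cons Pj.
Qed.

Lemma Ck_near_prod n k (I : Type) (r : seq I) (P : pred I)
    (F : I -> 'rV[R]_n -> R) x :
  (forall i, P i -> Ck_near k (F i) x) ->
  Ck_near k (fun y => \prod_(i <- r | P i) F i y) x.
Proof.
move=> kF; elim: r => [|j r IH].
  by apply: Ck_near_ext (Ck_near_cst _ 1 _) => y; rewrite big_nil.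
have [Pj|Pj] := boolP (P j); last first.
  by apply: Ck_near_ext IH => y; rewrite big_cons (negbTE Pj).
by apply: Ck_near_ext (Ck_nearM (kF _ Pj) IH) => y; rewrite big_cons Pj.
Qed.

Lemma Ck_nearN n k (F : 'rV[R]_n -> R) x :
  Ck_near k F x -> Ck_near k (fun y => - F y) x.
Proof.
move=> kF; apply: Ck_near_ext (Ck_nearM (Ck_near_cst _ (-1) _) kF) => y.
by rewrite mulN1r.
Qed.

Lemma Ck_nearV n k (F : 'rV[R]_n -> R) x :
  F x != 0 -> Ck_near k F x -> Ck_near k (fun y => (F y)^-1) x.
Proof.
elim: k F => [|k IH] F Fx0 kF; have [cF dF] := kF.
all: have F0 : \forall y \near x, F y != 0.
1,3: by have /cvgr_neq0 := nbhs_singleton cF; apply.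
all: split; first by apply: filterS2 cF F0 => y cFy Fy0; exact: continuousV.
  by [].
move=> i; have [dFi kFi] := dF i; split.
  by apply: filterS2 F0 dFi => y; exact: derivableV.
have kV := IH _ Fx0 (Ck_nearS kF).
apply: Ck_near_eq (Ck_nearN (Ck_nearM (Ck_nearM kV kV) kFi)).
apply: filterS2 F0 dFi => y Fy0 dFy; apply/esym; rewrite [LHS]deriveV//.
by rewrite -mulNr -exprVn -expr2.
Qed.

Lemma is_derive_coord n (i : 'I_n) (x v : 'rV[R]_n) :
  is_derive x v (fun y : 'rV[R]_n => y 0 i) (v 0 i).
Proof.
have did : derivable (id : 'rV[R]_n -> 'rV[R]_n) x v by exact: derivable_id.
split; first by have [/(_ did) + _] := derivable_mxP id x v; apply.
have /(congr1 (fun z : 'rV[R]_n => z 0 i)) := derive_mx did.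
by rewrite derive_id mxE.
Qed.

Lemma Ck_near_coord n k (i : 'I_n) x : Ck_near k (fun y : 'rV[R]_n => y 0 i) x.
Proof.
case: k => [|k]; split; first by apply: filterE => y; exact: coord_continuous.
- by [].
- by apply: filterE => y; exact: coord_continuous.
move=> j; split.
  by apply: filterE => y; case: (is_derive_coord i y (delta_mx 0 j)).
apply: Ck_near_ext (Ck_near_cst _ ((delta_mx 0 j : 'rV[R]_n) 0 i) _) => y.
by have [_ ->] := is_derive_coord i y (delta_mx 0 j).
Qed.

Lemma derive_comp_rV n m (F : 'rV[R]_n -> R) (Phi : 'rV[R]_m -> 'rV[R]_n)
    (y v : 'rV[R]_m) :
  (forall j, differentiable (fun z => Phi z 0 j) y) ->
  differentiable F (Phi y) ->
  differentiable (fun z => F (Phi z)) y /\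
  'D_v (fun z => F (Phi z)) y =
    \sum_j 'D_(delta_mx 0 j) F (Phi y) * 'D_v (fun z => Phi z 0 j) y.
Proof.
move=> dPhi dF.
have PhiE : Phi = \sum_j (fun z => Phi z 0 j *: (delta_mx 0 j : 'rV[R]_n)).
  by rewrite funeqE => z; rewrite fct_sumE [LHS]row_sum_delta.
have dP : differentiable Phi y.
  by rewrite PhiE; apply: differentiable_sum => j; exact: differentiableZl.
have dFP : differentiable (fun z => F (Phi z)) y := differentiable_comp dP dF.
split=> //; rewrite deriveE// (diff_comp dP dF) /=.
have -> : 'd Phi y v = \sum_j 'D_v (fun z => Phi z 0 j) y *: (delta_mx 0 j : 'rV[R]_n).
  rewrite -deriveE// derive_mx; last exact: diff_derivable.
  by rewrite [LHS]row_sum_delta; apply: eq_bigr => j _; rewrite mxE.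
rewrite linear_sum; apply: eq_bigr => j _.
by rewrite linearZ /= -deriveE// mulrC.
Qed.

Lemma continuous_rowP (T : topologicalType) n (Phi : T -> 'rV[R]_n) (y : T) :
  (forall j, {for y, continuous (fun z => Phi z 0 j)}) ->
  {for y, continuous Phi}.
Proof.
move=> cPhi; apply/cvgrPdist_le => e e0.
have : \forall z \near y, forall j, `|Phi y 0 j - Phi z 0 j| <= e.
  apply: (filter_forall (F := nbhs y)) => j.
  by have /cvgrPdist_le/(_ _ e0) := cPhi j.
apply: filterS => z Pz; apply: norm_le_coord (ltW e0) _ => j.
by rewrite !mxE; exact: Pz.
Qed.

(** Induction with F generalised and Phi fixed: the chain rule turns a partial derivative of the
    composite into products of partials of Phi with composites of partials of F, to which the
    induction hypothesis applies. *)
Lemma Ck_near_comp n m k (F : 'rV[R]_n -> R) (Phi : 'rV[R]_m -> 'rV[R]_n) x :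
  (forall j, Ck_near k (fun z => Phi z 0 j) x) ->
  Ck_near k F (Phi x) -> Ck_near k (fun z => F (Phi z)) x.
Proof.
elim: k F => [|k IH] F kPhi kF.
all: have cPhi : \forall y \near x, {for y, continuous Phi}.
1,3: have : \forall y \near x, forall j, {for y, continuous (fun z => Phi z 0 j)};
  [by apply: (filter_forall (F := nbhs x)) => j; have [] := kPhi j
  |by apply: filterS => y; exact: continuous_rowP].
all: have cPhix : Phi y @[y --> x] --> Phi x by exact: nbhs_singleton cPhi.
all: split; first by apply: filterS2 cPhi (cPhix _ (Ck_near_cont kF)) => y;
  exact: continuous_comp.
  by [].
have chain : \forall y \near x, forall i,
    derivable (fun z => F (Phi z)) y (delta_mx 0 i) /\
    \sum_j 'D_(delta_mx 0 j) F (Phi y) * 'D_(delta_mx 0 i) (fun z => Phi z 0 j) y =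
    'D_(delta_mx 0 i) (fun z => F (Phi z)) y.
  have dP : \forall y \near x, forall j, differentiable (fun z => Phi z 0 j) y.
    apply: (filter_forall (F := nbhs x)) => j.
    exact: Ck_near_differentiable (kPhi j).
  have dF := cPhix _ (Ck_near_differentiable kF).
  apply: filterS2 dP dF => y dPy dFy i.
  have [d E] := derive_comp_rV (delta_mx 0 i) dPy dFy.
  by split; [exact: diff_derivable|rewrite E].
move=> i; split; first by apply: filterS chain => y /(_ i)[].
apply: (@Ck_near_eq _ _ (fun y => \sum_j 'D_(delta_mx 0 j) F (Phi y) *
    'D_(delta_mx 0 i) (fun z => Phi z 0 j) y)).
  by apply: filterS chain => y /(_ i)[].
apply: Ck_near_sum => j _; apply: Ck_nearM.
  have [_ /(_ j)[_ kFj]] := kF.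
  exact: (IH _ (fun l => Ck_nearS (kPhi l)) kFj).
by case: (kPhi j) => _ /(_ i)[].
Qed.

(* For [phi] running through a family closed under differentiation. *)
Lemma Ck_near_comp1 n k (phi : nat -> R -> R) (c d : nat -> R)
    (F : 'rV[R]_n -> R) x :
  (forall m s, is_derive (s : R) (1 : R) (phi m) (c m * phi m.+1 s + d m * phi m.+2 s)) ->
  (forall l, Ck_near l F x) ->
  forall m, Ck_near k (fun z => phi m (F z)) x.
Proof.
move=> dphi kF.
have cphi m s : {for s, continuous (phi m)}.
  by apply: differentiable_continuous; apply/derivable1_diffP; case: (dphi m s).
elim: k => [|k IH] m.
all: split; first by apply: filterS (Ck_near_cont (kF 0%N)) => y cFy;
  exact: continuous_comp.
  by [].
have dF := Ck_near_differentiable (kF 1%N).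
have chain y v : differentiable F y ->
    differentiable (fun z => phi m (F z)) y /\
    (c m * phi m.+1 (F y) + d m * phi m.+2 (F y)) * 'D_v F y =
    'D_v (fun z => phi m (F z)) y.
  move=> dFy.
  have dp : differentiable (phi m) (F y).
    by apply/derivable1_diffP; case: (dphi m (F y)).
  have dpF : differentiable (fun z => phi m (F z)) y := differentiable_comp dFy dp.
  split=> //; rewrite [RHS]deriveE// (diff_comp dFy dp) /=.
  rewrite -(deriveE v dFy) -['D_v F y in RHS]mulr1 -[_ * 1]/(_ *: 1) linearZ /=.
  by rewrite -deriveE//; case: (dphi m (F y)) => _ ->; rewrite mulrC.
move=> i; split.
  by apply: filterS dF => y /(chain _ (delta_mx 0 i))[dy _]; exact: diff_derivable.
apply: (@Ck_near_eq _ _ (fun y => (c m * phi m.+1 (F y) + d m * phi m.+2 (F y)) *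
    'D_(delta_mx 0 i) F y)).
  by apply: filterS dF => y /(chain _ (delta_mx 0 i))[].
apply: Ck_nearM; last by case: (kF k.+1) => _ /(_ i)[].
by apply: Ck_nearD; apply: Ck_nearM (IH _); exact: Ck_near_cst.
Qed.

End SmoothGerms.

(** * Bump functions *)

Lemma Ck_onP (R : realType) (n k : nat) (U : set 'rV[R]_n) (F : 'rV[R]_n -> R) :
  open U -> Ck_on k U F <-> forall x, U x -> Ck_near k F x.
Proof.
move=> oU; have nU x : U x -> \forall y \near x, U y by move=> Ux; exact: open_nbhs_nbhs.
elim: k F => [|k IH] F; split.
- move=> [cF _] x Ux; split=> //.
  by apply: filterS (nU _ Ux) => y Uy; apply: cF; rewrite inE.
- move=> kF; split=> // x; rewrite inE => /kF /Ck_near_cont.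
  exact: nbhs_singleton.
- move=> [cF dF] x Ux; split.
    by apply: filterS (nU _ Ux) => y Uy; apply: cF; rewrite inE.
  move=> i; have [dFi /IH kFi] := dF i; split; last exact: kFi.
  by apply: filterS (nU _ Ux); exact: dFi.
- move=> kF; split.
    by move=> x; rewrite inE => /kF /Ck_near_cont; exact: nbhs_singleton.
  move=> i; split.
    by move=> x /kF [_ /(_ i)[+ _]]; exact: nbhs_singleton.
  by apply/IH => x /kF [_ /(_ i)[]].
Qed.

Lemma smooth_onP (R : realType) (n : nat) (U : set 'rV[R]_n) (F : 'rV[R]_n -> R) :
  open U -> smooth_on U F <-> forall x, U x -> Cinf_near F x.
Proof.
move=> oU; split=> [sF x Ux k|sF k].
  by have /(Ck_onP _ _ oU) := sF k; apply.
by apply/(Ck_onP _ _ oU) => x Ux; exact: sF.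
Qed.

Section Bump.
Variable R : realType.

(* This family is closed under differentiation: the derivative of the m-th
   function is the (m+2)-nd minus m times the (m+1)-st. *)
Definition flat_exp (m : nat) (s : R) : R :=
  if 0 < s then s ^- m * expR (- s^-1) else 0.

Lemma flat_exp_ge0 m s : 0 <= flat_exp m s.
Proof.
rewrite /flat_exp; case: ifP => // s0.
by rewrite mulr_ge0 ?expR_ge0// invr_ge0 exprn_ge0// ltW.
Qed.

(** From 1 + x <= e^x at x = 1/((m+1)s), raised to the power m + 1. The linear bound is what forces
    the derivative at 0 to vanish. *)
Lemma flat_exp_le m s : flat_exp m s <= m.+1%:R ^+ m.+1 * `|s|.
Proof.
rewrite /flat_exp; case: ifP => [s0|_]; last by rewrite mulr_ge0// exprn_ge0.
have ms0 : 0 <= m.+1%:R^-1 * s^-1 by rewrite mulr_ge0// invr_ge0 ltW.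
have le_exp : (m.+1%:R^-1 * s^-1) ^+ m.+1 <= expR s^-1.
  rewrite -[s^-1 in leRHS](mulVKf (_ : m.+1%:R != 0))// expRM_natl.
  rewrite lerXn2r ?nnegrE ?expR_ge0// (le_trans _ (expR_ge1Dx _))//.
  by rewrite lerDr.
rewrite (gtr0_norm s0) expRN ler_pdivrMr ?expR_gt0//.
apply: le_trans (ler_wpM2l _ le_exp); last by rewrite mulr_ge0 ?exprn_ge0// ltW.
rewrite exprMn mulrACA -exprMn mulfV// expr1n mul1r.
by rewrite exprS mulrA mulfV ?gt_eqF// mul1r exprVn.
Qed.

Lemma is_derive_flat_exp m (s : R) :
  is_derive s (1 : R) (flat_exp m)
    (- m%:R * flat_exp m.+1 s + 1 * flat_exp m.+2 s).
Proof.
have [s0|s0|->] := ltgtP s 0.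
- rewrite /flat_exp !ltNge (ltW s0) /= !mulr0 addr0.
  apply: (@near_eq_is_derive _ _ _ (cst (0 : R))).
  by near=> y; rewrite ifF// ltNge ltW//; near: y; exact: lt_nbhsl.
- have sn0 : s != 0 by rewrite gt_eqF.
  have DV : is_derive s (1 : R) (fun y : R => y^-1) (- s ^- 2 *: 1).
    exact: (@is_deriveV _ id).
  have DX := is_deriveX m DV.
  have DN := is_deriveN DV.
  have DE := @is_derive1_comp _ expR _ _ _ _ (is_derive_expR _) DN.
  have D := is_deriveM DX DE.
  apply: (@near_eq_is_derive _ _ _ ((fun y : R => y^-1) ^+ m *
      (expR \o (- (fun y : R => y^-1))))).
    near=> y; rewrite /flat_exp ifT; last by near: y; exact: lt_nbhsr.
    by rewrite -exprVn !fctE.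
  apply: (@is_derive_eq _ _ _ _ _ _ _ _ D).
  rewrite /flat_exp s0 !fctE /= -[_ *: 1]/(_ * 1) -![_ *: _]/(_ * _).
  (* The factor [m%:R] absorbs the case m = 0, where [m.-1] is 0 instead of -1. *)
  have -> : m%:R * s^-1 ^+ m.-1 = m%:R * (s^-1 ^+ m * s).
    case: m {DX D} => [|m] /=; first by rewrite !mul0r.
    by rewrite exprSr -mulrA mulVf// mulr1.
  rewrite -!exprVn !exprS; move: (s^-1 ^+ m) (m%:R) (expR (- s^-1)) => a b c.
  by field.
- rewrite /flat_exp ltxx !mulr0 addr0 -/(flat_exp m).
  (* At 0 the difference quotient of [flat_exp m] is [flat_exp m.+1], squeezed to 0 by
     [flat_exp_le]. *)
  have L : h^-1 *: ((flat_exp m \o shift 0) (h *: 1) - flat_exp m 0)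
      @[h --> (0:R)^'] --> (0:R).
    apply/cvgrPdist_le => e e0; near=> h.
    rewrite /flat_exp ltxx subr0 sub0r normrN /= addr0 -[h *: 1]/(h * 1) mulr1.
    rewrite -/(flat_exp m h).
    have -> : h^-1 *: flat_exp m h = flat_exp m.+1 h.
      rewrite /flat_exp; case: ifP => _; last by rewrite scaler0.
      by rewrite -[_ *: _]/(_ * _) mulrA -!exprVn exprS.
    rewrite ger0_norm ?flat_exp_ge0// (le_trans (flat_exp_le _ _))//.
    rewrite -ler_pdivlMl ?exprn_gt0//; near: h; apply: dnbhs0_le.
    by rewrite mulr_gt0// invr_gt0 exprn_gt0.
  by split; [apply/cvg_ex; exists 0|apply/cvg_lim].
Unshelve. all: by end_near. Qed.

Lemma Ck_near_flat_exp n k (F : 'rV[R]_n -> R) x :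
  (forall l, Ck_near l F x) -> Ck_near k (fun y => flat_exp 0 (F y)) x.
Proof.
move=> kF; apply: (@Ck_near_comp1 R n k flat_exp (fun m => - m%:R) (fun=> 1)) => //.
exact: is_derive_flat_exp.
Qed.

(** Nonzero exactly on the open cube of radius r around a, which is a ball for the maximum norm of
    row vectors. *)
Definition box_bump n (a : 'rV[R]_n) (r : R) (x : 'rV[R]_n) : R :=
  \prod_i (flat_exp 0 (r + (x 0 i - a 0 i)) * flat_exp 0 (r + (a 0 i - x 0 i))).

Lemma Ck_near_box_bump n k (a : 'rV[R]_n) (r : R) x : Ck_near k (box_bump a r) x.
Proof.
apply: Ck_near_prod => i _; apply: Ck_nearM; apply: Ck_near_flat_exp => l.
- by apply: Ck_nearD; [|apply: Ck_nearD];
    [exact: (@Ck_near_cst R n l r)|exact: Ck_near_coord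
    |exact: (@Ck_near_cst R n l (- a 0 i))].
- by apply: Ck_nearD; [|apply: Ck_nearD];
    [exact: (@Ck_near_cst R n l r)|exact: (@Ck_near_cst R n l (a 0 i))
    |apply: Ck_nearN; exact: Ck_near_coord].
Qed.

Lemma box_bump_neq0 n (a : 'rV[R]_n) (r : R) : 0 < r -> box_bump a r a != 0.
Proof.
move=> r0; apply/prodf_neq0 => i _.
have e0 : flat_exp 0 r != 0.
  by rewrite /flat_exp r0 expr0 invr1 mul1r gt_eqF// expR_gt0.
by rewrite subrr addr0 mulf_neq0.
Qed.

Lemma box_bump_out n (a : 'rV[R]_n) (r : R) x :
  0 <= r -> box_bump a r x != 0 -> `|x - a| <= r.
Proof.
move=> r0 /prodf_neq0 bx; apply: norm_le_coord => // i.
have := bx i isT; rewrite mulf_eq0 negb_or /flat_exp !mxE => /andP[].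
case: ifP; rewrite ?eqxx// => r1 _; case: ifP; rewrite ?eqxx// => r2 _.
by rewrite ler_norml; apply/andP; split; lra.
Qed.
End Bump.

(** * Smooth functions and tangent vectors on manifolds *)

Section ManifoldSmooth.
Variables (R : realType) (n : nat) (M : manifold R n).
Implicit Types (c d : chart R n M) (p q : M) (u v : M -> R).

Lemma near_dom c p : dom c p -> \forall q \near p, dom c q.
Proof. by move=> cp; apply: open_nbhs_nbhs; split=> //; exact: dom_open. Qed.

Lemma near_img c p : dom c p ->
  \forall x \near chart_map c p, (chart_map c @` dom c) x.
Proof.
by move=> cp; apply: open_nbhs_nbhs; split; [exact: img_open|exists p].
Qed.

Lemma chart_map_cvg c p : dom c p -> {for p, continuous (chart_map c)}.
Proof.
move=> cp; have := @chart_map_continuous _ _ _ c.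
by rewrite continuous_open_subspace; [apply; rewrite inE|exact: dom_open].
Qed.

Lemma chart_inv_cvg c p : dom c p ->
  {for chart_map c p, continuous (chart_inv c)}.
Proof.
move=> cp; have := @chart_inv_continuous _ _ _ c.
rewrite continuous_open_subspace; last exact: img_open.
by apply; rewrite inE; exists p.
Qed.

Lemma chart_mapKp c p : dom c p -> chart_inv c (chart_map c p) = p.
Proof. by move=> cp; apply: chart_mapK; rewrite inE. Qed.

Lemma near_chart_inv c p (P : M -> Prop) : dom c p ->
  (\forall q \near p, P q) -> \forall x \near chart_map c p, P (chart_inv c x).
Proof.
move=> cp nP; have := chart_inv_cvg cp; rewrite /prop_for /continuous_at.
by rewrite (chart_mapKp cp) => /(_ _ nP).
Qed.

Lemma near_transition c d p : dom c p -> dom d p ->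
  \forall x \near chart_map c p,
    chart_inv d (chart_map d (chart_inv c x)) = chart_inv c x.
Proof.
move=> cp dp; have := near_chart_inv cp (near_dom dp).
by apply: filterS => x; exact: chart_mapKp.
Qed.

Lemma transition_Cinf c d p (j : 'I_n) : atlas c -> atlas d -> dom c p -> dom d p ->
  Cinf_near (fun x => chart_map d (chart_inv c x) 0 j) (chart_map c p).
Proof.
move=> ac ad cp dp.
(* Compatibility of charts gives germs only once the image of the overlap is known to be open; this
   follows from the continuity of [chart_inv c]. *)
suff oU : open (chart_map c @` (dom c `&` dom d)).
  have /(smooth_onP _ oU) := atlas_compatible ac ad j.
  by apply; exists p.
rewrite openE => _ [q [cq dq] <-]; rewrite /interior.
apply: filterS2 (near_img cq) (near_chart_inv cq (near_dom dq)).
by move=> _ [q' cq' <-]; rewrite chart_mapKp// => dq'; exists q'.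
Qed.

Definition smooth_at u p := exists c,
  [/\ atlas c, dom c p & Cinf_near (fun x => u (chart_inv c x)) (chart_map c p)].

(** Near p the expression of u in c is its expression in d composed with a smooth transition map;
    one chart thus suffices in [smooth_at]. *)
Lemma smooth_at_chart u p c : atlas c -> dom c p -> smooth_at u p ->
  Cinf_near (fun x => u (chart_inv c x)) (chart_map c p).
Proof.
move=> ac cp [d [ad dp du]] k.
apply: (@Ck_near_eq _ _ _
    (fun x => u (chart_inv d (chart_map d (chart_inv c x))))).
  by apply: filterS (near_transition cp dp) => x ->.
apply: (@Ck_near_comp _ _ _ _ (fun y => u (chart_inv d y))
    (fun x => chart_map d (chart_inv c x))).
  by move=> j; exact: transition_Cinf.
by rewrite chart_mapKp//; exact: du.
Qed.

Lemma smoothP u : smooth u <-> forall p, smooth_at u p.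
Proof.
split=> [su p|su c ac].
  have [c ac cp] := atlas_cover p; exists c; split=> //.
  by have /(smooth_onP _ (@img_open _ _ _ c)) := su c ac; apply; exists p.
apply/(smooth_onP _ (@img_open _ _ _ c)) => _ [p cp <-].
exact: smooth_at_chart.
Qed.

Lemma smooth_at_near_eq u v p :
  (\forall q \near p, u q = v q) -> smooth_at u p -> smooth_at v p.
Proof.
move=> uv [c [ac cp su]]; exists c; split=> // k.
by apply: Ck_near_eq (su k); exact: (near_chart_inv cp uv).
Qed.

Lemma smooth_at_continuous u p : smooth_at u p -> {for p, continuous u}.
Proof.
move=> [c [ac cp /(_ 0%N) /Ck_near_cont /nbhs_singleton cu]].
apply: (@near_eq_continuous_at _ _
    ((fun x => u (chart_inv c x)) \o chart_map c)).
  by apply: filterS (near_dom cp) => q cq /=; rewrite chart_mapKp.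
apply: continuous_comp => //; exact: chart_map_cvg.
Qed.

Lemma smooth_at_neq0 u p : smooth_at u p -> u p != 0 ->
  \forall q \near p, u q != 0.
Proof. by move=> /smooth_at_continuous cu up0; apply: cvgr_neq0 cu up0. Qed.

Lemma smooth_at_cst (k : R) p : smooth_at (fun=> k) p.
Proof.
have [c ac cp] := atlas_cover p; exists c; split=> // l.
exact: Ck_near_cst.
Qed.

Lemma smooth_atD u v p : smooth_at u p -> smooth_at v p ->
  smooth_at (fun q => u q + v q) p.
Proof.
move=> [c [ac cp su]] /(smooth_at_chart ac cp) sv; exists c; split=> // l.
by apply: Ck_nearD; [exact: su|exact: sv].
Qed.

Lemma smooth_atM u v p : smooth_at u p -> smooth_at v p ->
  smooth_at (fun q => u q * v q) p.
Proof.
move=> [c [ac cp su]] /(smooth_at_chart ac cp) sv; exists c; split=> // l.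
by apply: Ck_nearM; [exact: su|exact: sv].
Qed.

Lemma smooth_atV u p : u p != 0 -> smooth_at u p ->
  smooth_at (fun q => (u q)^-1) p.
Proof.
move=> up0 [c [ac cp su]]; exists c; split=> // l.
by apply: Ck_nearV; [rewrite chart_mapKp|exact: su].
Qed.

Lemma smooth_atN u p : smooth_at u p -> smooth_at (fun q => - u q) p.
Proof.
move=> su; apply: smooth_at_near_eq (smooth_atM (smooth_at_cst (-1) p) su).
by apply: filterE => q; rewrite mulN1r.
Qed.

Lemma smooth_at_sum (I : Type) (r : seq I) (P : pred I) (F : I -> M -> R) p :
  (forall i, P i -> smooth_at (F i) p) ->
  smooth_at (fun q => \sum_(i <- r | P i) F i q) p.
Proof.
have [c ac cp] := atlas_cover p => sF; exists c; split=> // k.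
by apply: Ck_near_sum => i Pi; exact: (smooth_at_chart ac cp (sF i Pi)).
Qed.

Lemma smooth_at_prod (I : Type) (r : seq I) (P : pred I) (F : I -> M -> R) p :
  (forall i, P i -> smooth_at (F i) p) ->
  smooth_at (fun q => \prod_(i <- r | P i) F i q) p.
Proof.
have [c ac cp] := atlas_cover p => sF; exists c; split=> // k.
by apply: Ck_near_prod => i Pi; exact: (smooth_at_chart ac cp (sF i Pi)).
Qed.

Lemma smooth_at_det m (B : M -> 'M[R]_m) p :
  (forall i j, smooth_at (fun q => B q i j) p) ->
  smooth_at (fun q => \det (B q)) p.
Proof.
move=> sB; apply: smooth_at_sum => s _; apply: smooth_atM.
  exact: smooth_at_cst.
exact: smooth_at_prod.
Qed.

(** Cofactors are polynomial in the entries, so no invertibility is involved; the adjugate replaces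
    [invmx] wherever smoothness is at stake. *)
Lemma smooth_at_adj m (B : M -> 'M[R]_m) p i j :
  (forall i j, smooth_at (fun q => B q i j) p) ->
  smooth_at (fun q => \adj (B q) i j) p.
Proof.
move=> sB; apply: (@smooth_at_near_eq (fun q => cofactor (B q) j i)).
  by apply: filterE => q; rewrite mxE.
apply: smooth_atM; first exact: smooth_at_cst.
apply: smooth_at_det => k l.
apply: smooth_at_near_eq (sB (lift j k) (lift i l)).
by apply: filterE => q; rewrite !mxE.
Qed.

Lemma smooth_smooth_at u p : smooth u -> smooth_at u p.
Proof. by move=> /smoothP. Qed.

End ManifoldSmooth.

Lemma derive_rV (R : realType) (n : nat) (F : 'rV[R]_n -> R) (x v : 'rV[R]_n) :
  differentiable F x ->
  'D_v F x = \sum_j v 0 j * 'D_(delta_mx 0 j) F x.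
Proof.
move=> dF; rewrite deriveE// [in LHS](row_sum_delta v) linear_sum.
by apply: eq_bigr => j _; rewrite linearZ /= -deriveE.
Qed.

(** * Tangent vectors under change of chart, and their derivation rules *)

Section Tangent.
Variables (R : realType) (n : nat) (M : manifold R n).
Implicit Types (c d : chart R n M) (p q : M) (u w : M -> R).
Implicit Types (v : (M -> R) -> R^o) (X Y : rawfield M).

Lemma chart_vectorE c p (a : 'rV[R]_n) u : atlas c -> dom c p -> smooth u ->
  chart_vector c p a u =
  \sum_j a 0 j * 'D_(delta_mx 0 j) (fun x => u (chart_inv c x)) (chart_map c p).
Proof.
move=> ac cp su; rewrite /chart_vector; case: asboolP => // _.
apply/derive_rV/Cinf_near_differentiable/smooth_at_chart => //.
exact: smooth_smooth_at.
Qed.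

Lemma chart_vector_nonsmooth c p (a : 'rV[R]_n) u :
  ~ smooth u -> chart_vector c p a u = 0.
Proof. by move=> su; rewrite /chart_vector; case: asboolP. Qed.

Lemma chart_vector_lin c p (k : R) (a b : 'rV[R]_n) : atlas c -> dom c p ->
  chart_vector c p (k *: a + b) = k *: chart_vector c p a + chart_vector c p b.
Proof.
move=> ac cp; apply/funext => u; rewrite !fctE.
have [su|su] := pselect (smooth u); last first.
  by rewrite !chart_vector_nonsmooth// scaler0 addr0.
rewrite !chart_vectorE// scaler_sumr -big_split /=; apply: eq_bigr => j _.
by rewrite !mxE mulrDl -mulrA.
Qed.

Lemma chart_vector0 c p : atlas c -> dom c p ->
  chart_vector c p (0 : 'rV[R]_n) = 0.
Proof.
move=> ac cp; have := chart_vector_lin (-1) 0 0 ac cp.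
by rewrite scaler0 addr0 scaleN1r addNr.
Qed.

Lemma chart_vector_delta c p (a : 'rV[R]_n) : atlas c -> dom c p ->
  chart_vector c p a = \sum_i a 0 i *: chart_vector c p (delta_mx 0 i).
Proof.
move=> ac cp; rewrite {1}(row_sum_delta a).
elim: (index_enum _) => [|i r IH]; first by rewrite !big_nil chart_vector0.
by rewrite !big_cons chart_vector_lin// IH.
Qed.

(** The chain rule settles smooth functions; on all others both operators are 0, so they are equal
    as functions. *)
Lemma chart_vector_change c d p (a : 'rV[R]_n) :
  atlas c -> dom c p -> atlas d -> dom d p ->
  chart_vector d p a = chart_vector c p
    (\row_j 'D_a (fun x => chart_map c (chart_inv d x) 0 j) (chart_map d p)).
Proof.
move=> ac cp ad dp; apply/funext => u.
have [su|su] := pselect (smooth u); last by rewrite !chart_vector_nonsmooth.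
rewrite [RHS]chart_vectorE// /chart_vector; case: asboolP => // _.
rewrite (@near_eq_derive _ _ _ _
    (fun x => u (chart_inv c (chart_map c (chart_inv d x))))); last first.
  by apply: filterS (near_transition dp cp) => x ->.
have [|_ ->] := @derive_comp_rV _ _ _ (fun y => u (chart_inv c y))
    (fun x => chart_map c (chart_inv d x)) (chart_map d p) a
    (fun j => Cinf_near_differentiable (transition_Cinf j ad ac dp cp)).
  rewrite chart_mapKp//; apply/Cinf_near_differentiable/smooth_at_chart => //.
  exact: smooth_smooth_at.
by rewrite chart_mapKp//; apply: eq_bigr => j _; rewrite mxE mulrC.
Qed.

(** Two tangent vectors may be given in different charts; expressing both in one fixed chart is what
    allows adding them. *)
Lemma tangentP c p v : atlas c -> dom c p ->
  tangent p v <-> exists b, v = chart_vector c p b.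
Proof.
move=> ac cp; split=> [[d [a [ad dp ->]]]|[b ->]]; last by exists c, b.
by eexists; exact: chart_vector_change.
Qed.

Lemma tangent_lin p (k : R) v v' :
  tangent p v -> tangent p v' -> tangent p (k *: v + v').
Proof.
have [c ac cp] := atlas_cover p.
move=> /(tangentP _ ac cp)[a ->] /(tangentP _ ac cp)[b ->].
by apply/(tangentP _ ac cp); exists (k *: a + b); rewrite chart_vector_lin.
Qed.

Lemma tangent0 p : tangent p 0.
Proof.
have [c ac cp] := atlas_cover p.
by apply/(tangentP _ ac cp); exists 0; rewrite chart_vector0.
Qed.

Lemma smooth_chart_differentiable c p u : atlas c -> dom c p -> smooth u ->
  differentiable (fun x => u (chart_inv c x)) (chart_map c p).
Proof.
move=> ac cp su; apply/Cinf_near_differentiable/smooth_at_chart => //.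
exact: smooth_smooth_at.
Qed.

Lemma smoothD u w : smooth u -> smooth w -> smooth (fun q => u q + w q).
Proof.
move=> /smoothP su /smoothP sw; apply/smoothP => p; exact: smooth_atD.
Qed.

Lemma smoothM u w : smooth u -> smooth w -> smooth (fun q => u q * w q).
Proof.
move=> /smoothP su /smoothP sw; apply/smoothP => p; exact: smooth_atM.
Qed.

Lemma smoothN u : smooth u -> smooth (fun q => - u q).
Proof. by move=> /smoothP su; apply/smoothP => p; exact: smooth_atN. Qed.

Lemma smooth_cst (k : R) : @smooth R n M (fun=> k).
Proof. by apply/smoothP => p; exact: smooth_at_cst. Qed.

Lemma tangentD p v u w : tangent p v -> smooth u -> smooth w ->
  v (fun q => u q + w q) = v u + v w.
Proof.
move=> [c [a [ac cp ->]]] su sw.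
rewrite /chart_vector !asboolT//; last exact: smoothD.
by apply: deriveD; apply: diff_derivable; exact: smooth_chart_differentiable.
Qed.

Lemma tangentM p v u w : tangent p v -> smooth u -> smooth w ->
  v (fun q => u q * w q) = u p * v w + w p * v u.
Proof.
move=> [c [a [ac cp ->]]] su sw.
rewrite /chart_vector !asboolT//; last exact: smoothM.
rewrite -derive_mul_fun ?chart_mapKp//; apply: diff_derivable;
  exact: smooth_chart_differentiable.
Qed.

Lemma tangentN p v u : tangent p v -> smooth u -> v (fun q => - u q) = - v u.
Proof.
move=> [c [a [ac cp ->]]] su.
rewrite /chart_vector !asboolT//; last exact: smoothN.
by apply: deriveN; apply: diff_derivable; exact: smooth_chart_differentiable.
Qed.

Lemma vfield_lin (h : M -> R) X Y : smooth h -> vfield X -> vfield Y ->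
  vfield (fscale h X + Y).
Proof.
move=> sh [tX sX] [tY sY]; split=> [p|u su]; first exact: tangent_lin.
by apply: smoothD; [apply: smoothM => //; exact: sX|exact: sY].
Qed.

Lemma vfield0 : vfield (0 : rawfield M).
Proof. by split=> [p|u _]; [exact: tangent0|exact: smooth_cst]. Qed.

End Tangent.

(** * Local frames of global vector fields *)

Section Cutoff.
Variables (R : realType) (n : nat) (M : manifold R n) (c : chart R n M).
Variables (x0 : 'rV[R]_n) (r : R).
Hypotheses (ac : atlas c) (r0 : 0 < r).
Hypothesis box_img : forall x, `|x - x0| <= r -> (chart_map c @` dom c) x.

Definition cutoff (F : 'rV[R]_n -> R) (q : M) : R :=
  if `[< dom c q >]
  then box_bump x0 r (chart_map c q) * F (chart_map c q) else 0.

(* Hausdorffness enters here: the compact image of the box is closed in M, so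
   the cutoff vanishes near every point outside the chart domain. *)
Lemma cutoff_near0 F p : ~ dom c p -> \forall q \near p, cutoff F q = 0.
Proof.
move=> ncp; pose K := [set x | `|x - x0| <= r].
have cK : compact K.
  apply: bounded_closed_compact.
    exists (`|x0| + r); split; first exact: num_real.
    move=> m Hm x Kx; apply: le_trans (ltW Hm).
    by rewrite -[x](subrKC x0) (le_trans (ler_normD _ _))// lerD2l.
  rewrite (_ : K = closed_ball_ Num.norm x0 r); first exact: closed_closed_ball_.
  by apply/seteqP; split=> x; rewrite /K /closed_ball_ /= distrC.
have clK : closed (chart_inv c @` K).
  apply: compact_closed; first exact: space_hausdorff.
  apply: continuous_compact cK; apply: continuous_subspaceW (@chart_inv_continuous _ _ _ c).
  exact: box_img.
have : \forall q \near p, ~ (chart_inv c @` K) q.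
  apply: open_nbhs_nbhs; split; first by rewrite -closedC setCK.
  by move=> [x /box_img [q cq <-] pE]; apply: ncp; rewrite -pE chart_mapKp.
apply: filterS => q nKq; rewrite /cutoff; case: asboolP => // cq.
have [->|b0] := eqVneq (box_bump x0 r (chart_map c q)) 0; first by rewrite mul0r.
case: nKq; exists (chart_map c q); last exact: chart_mapKp.
by apply: box_bump_out b0; exact: ltW.
Qed.

Lemma smooth_cutoff F :
  (forall x, (chart_map c @` dom c) x -> Cinf_near F x) -> smooth (cutoff F).
Proof.
move=> sF; apply/smoothP => p; have [cp|ncp] := pselect (dom c p); last first.
  apply: smooth_at_near_eq (smooth_at_cst 0 p).
  by apply: filterS (cutoff_near0 F ncp) => q ->.
exists c; split=> // k.
apply: (@Ck_near_eq _ _ _ (fun x => box_bump x0 r x * F x)).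
  apply: filterS (near_img cp) => _ [q cq <-].
  by rewrite /cutoff chart_mapKp// asboolT.
by apply: Ck_nearM; [exact: Ck_near_box_bump|apply: sF; exists p].
Qed.

Definition cutoff_coord (j : 'I_n) : M -> R := cutoff (fun x => (x - x0) 0 j).

Definition cutoff_field (i : 'I_n) : rawfield M := fun q =>
  if `[< dom c q >]
  then box_bump x0 r (chart_map c q) *: chart_vector c q (delta_mx 0 i) else 0.

Lemma smooth_cutoff_coord j : smooth (cutoff_coord j).
Proof.
apply: smooth_cutoff => x _ k.
apply: (@Ck_near_ext _ _ _ (fun y => y 0 j + - x0 0 j)).
  by move=> y; rewrite !mxE.
by apply: Ck_nearD; [exact: Ck_near_coord|exact: (@Ck_near_cst R n k (- x0 0 j))].
Qed.

Lemma vfield_cutoff_field i : vfield (cutoff_field i).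
Proof.
split=> [q|u su].
  rewrite /cutoff_field; case: asboolP => [cq|_]; last exact: tangent0.
  apply/(tangentP _ ac cq); exists (box_bump x0 r (chart_map c q) *: delta_mx 0 i).
  have := chart_vector_lin (box_bump x0 r (chart_map c q)) (delta_mx 0 i) 0 ac cq.
  by rewrite addr0 chart_vector0// addr0 => ->.
rewrite (_ : lie _ u =
    cutoff (fun x => 'D_(delta_mx 0 i) (fun y => u (chart_inv c y)) x)).
  apply: smooth_cutoff => _ [p cp <-] k.
  have /(smooth_smooth_at p)/(smooth_at_chart ac cp)/(_ k.+1) := su.
  by case=> _ /(_ i)[].
apply/funext => q; rewrite /lie /cutoff_field /cutoff; case: asboolP => // cq.
by rewrite fctE /chart_vector asboolT.
Qed.

Definition cutoff_mx (q : M) : 'M[R]_n :=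
  \matrix_(i, j) lie (cutoff_field i) (cutoff_coord j) q.

(** Cramer's rule: if v = sum y_i E_i, then the row of the v(w_j) is y B, and y B adj(B) = det(B)
    y. *)
Lemma cutoff_expand q (v : (M -> R) -> R^o) : tangent q v ->
  \det (cutoff_mx q) *: v =
  \sum_i ((\row_j v (cutoff_coord j)) *m \adj (cutoff_mx q)) 0 i *: cutoff_field i q.
Proof.
have [d ad dq] := atlas_cover q => /[dup] tv /(tangentP _ ad dq)[b vb].
(* For n = 0 the empty determinant is 1 and cannot annihilate v; instead v itself is 0. *)
have [n0|n0] := posnP n.
  have noI : 'I_n -> False by rewrite n0 => -[].
  have -> : v = 0.
    by rewrite vb (_ : b = 0) ?chart_vector0//; apply/rowP => i; case: (noI i).
  by rewrite scaler0 big1// => i; case: (noI i).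
(* Where all fields vanish the matrix is 0 and, as n > 0, both sides are 0. Elsewhere q is in the
   chart and the bump is nonzero, so the fields span the tangent space. *)
have [Z|NZ] := pselect (forall i, cutoff_field i q = 0).
  rewrite (_ : cutoff_mx q = 0%:M) ?det_scalar ?expr0n.
    rewrite gtn_eqF// scale0r big1// => i _; by rewrite Z scaler0.
  by apply/matrixP => i j; rewrite !mxE mul0rn /lie Z.
have cq : dom c q.
  by apply: contrapT => ncq; apply: NZ => i; rewrite /cutoff_field asboolF.
have cfE i : cutoff_field i q =
    box_bump x0 r (chart_map c q) *: chart_vector c q (delta_mx 0 i).
  by rewrite /cutoff_field asboolT.
have b0 : box_bump x0 r (chart_map c q) != 0.
  by apply/eqP => bE; apply: NZ => i; rewrite cfE bE scale0r.
have /(tangentP _ ac cq)[a va] := tv.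
pose y : 'rV[R]_n := (box_bump x0 r (chart_map c q))^-1 *: a.
have vy : v = \sum_i y 0 i *: cutoff_field i q.
  rewrite va chart_vector_delta//; apply: eq_bigr => i _.
  by rewrite cfE scalerA mxE mulrAC mulVf// mul1r.
have -> : \row_j v (cutoff_coord j) = y *m cutoff_mx q.
  apply/rowP => j; rewrite !mxE vy fct_sumE; apply: eq_bigr => i _.
  by rewrite fctE !mxE.
rewrite -mulmxA mul_mx_adj mul_mx_scalar vy scaler_sumr; apply: eq_bigr => i _.
by rewrite scalerA [in RHS]mxE.
Qed.

(** At the centre the matrix is b^2 times the identity, b being the value of the bump there: one b
    comes from the field, the other from the coordinate, whose factor x - x0 vanishes and removes
    the derivative of the bump. *)
Lemma cutoff_det p : dom c p -> chart_map c p = x0 -> \det (cutoff_mx p) != 0.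
Proof.
move=> cp px0; have b0 := box_bump_neq0 x0 r0.
suff -> : cutoff_mx p = (box_bump x0 r x0 * box_bump x0 r x0)%:M.
  by rewrite det_scalar expf_neq0// mulf_neq0.
apply/matrixP => i j; rewrite !mxE /lie /cutoff_field asboolT// fctE px0.
rewrite /chart_vector asboolT; last exact: smooth_cutoff_coord.
rewrite (@near_eq_derive _ _ _ _ (fun x => box_bump x0 r x * (x - x0) 0 j)); last first.
  apply: filterS (near_img cp) => _ [q cq <-].
  by rewrite /cutoff_coord /cutoff chart_mapKp// asboolT.
have db : differentiable (box_bump x0 r) x0.
  by apply: Cinf_near_differentiable => k; exact: Ck_near_box_bump.
have dx : is_derive x0 (delta_mx 0 i) (fun x : 'rV[R]_n => (x - x0) 0 j)
    ((delta_mx 0 i : 'rV[R]_n) 0 j).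
  apply: (@near_eq_is_derive _ _ _ (fun x : 'rV[R]_n => x 0 j - x0 0 j)).
    by apply: filterE => x; rewrite !mxE.
  have := is_deriveB (is_derive_coord j x0 (delta_mx 0 i)) (is_derive_cst (x0 0 j) x0 (delta_mx 0 i)).
  by rewrite subr0.
rewrite px0 -derive_mul_fun; [|exact: diff_derivable|by case: dx].
case: dx => _ ->; rewrite subrr !mxE mul0r addr0 eqxx /= [_ == j]eq_sym.
by rewrite -[RHS]mulr_natr -[_ *: _]/(_ * _) mulrA.
Qed.

End Cutoff.

(* On the nonzero set of the determinant the E i form a frame with smooth dual
   data w; the expansion is multiplied through by the determinant so that it
   holds on the whole manifold, with smooth coefficients. *)
Lemma local_frame (R : realType) (n : nat) (M : manifold R n) (p : M) :
  exists (E : 'I_n -> rawfield M) (w : 'I_n -> M -> R),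
  [/\ forall i, vfield (E i), forall j, smooth (w j),
      \det (\matrix_(i, j) lie (E i) (w j) p) != 0 &
      forall q v, tangent q v ->
        \det (\matrix_(i, j) lie (E i) (w j) q) *: v =
        \sum_i ((\row_j v (w j)) *m
                \adj (\matrix_(i, j) lie (E i) (w j) q)) 0 i *: E i q].
Proof.
have [c ac cp] := atlas_cover p.
have /nbhs_ballP[e /= e0 He] := near_img cp.
(* Half the radius, so that the closed box lies in the open ball contained in the chart image. *)
have e20 : 0 < e / 2 by rewrite divr_gt0.
have box x : `|x - chart_map c p| <= e / 2 -> (chart_map c @` dom c) x.
  move=> xe; apply: He; rewrite -ball_normE /= distrC (le_lt_trans xe)//.
  by rewrite ltr_pdivrMr// ltr_pMr// ltr1n.
exists (cutoff_field c (chart_map c p) (e / 2)).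
exists (cutoff_coord c (chart_map c p) (e / 2)); split.
- exact: vfield_cutoff_field.
- exact: smooth_cutoff_coord.
- exact: cutoff_det.
- exact: cutoff_expand.
Qed.

(** * Traces *)

Section Frames.
Variables (R : realType) (n : nat) (M : manifold R n).
Implicit Types (p q : M) (X Y : rawfield M) (E : 'I_n -> rawfield M).
Implicit Types (A : rawfield M -> rawfield M).

Lemma tangent_sum (I : Type) (r : seq I) p (a : I -> R)
    (v : I -> (M -> R) -> R^o) :
  (forall i, tangent p (v i)) -> tangent p (\sum_(i <- r) a i *: v i).
Proof.
move=> tv; elim: r => [|i r IH]; first by rewrite big_nil; exact: tangent0.
by rewrite big_cons; exact: tangent_lin.
Qed.

Lemma vfield_sum (I : Type) (r : seq I) (a : I -> M -> R) (X : I -> rawfield M) :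
  (forall i, smooth (a i)) -> (forall i, vfield (X i)) ->
  vfield (\sum_(i <- r) fscale (a i) (X i)).
Proof.
move=> sa vX; elim: r => [|i r IH]; first by rewrite big_nil; exact: vfield0.
by rewrite big_cons; exact: vfield_lin.
Qed.

Lemma frame_coef p E (v : 'I_n -> (M -> R) -> R^o) :
  frame_at p E -> (forall j, tangent p (v j)) ->
  exists a : 'M[R]_n, forall j, v j = \sum_i a i j *: E i p.
Proof.
move=> [_ fE] tv; have /choice[b bE] j : exists b : 'rV[R]_n,
    v j = \sum_i b 0 i *: E i p by have [b [+ _]] := fE _ (tv j); exists b.
exists (\matrix_(i, j) b j 0 i) => j; rewrite bE.
by apply: eq_bigr => i _; rewrite mxE.
Qed.

Lemma frame_coef_inj p E (a b : 'M[R]_n) : frame_at p E ->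
  (forall j, \sum_i a i j *: E i p = \sum_i b i j *: E i p) -> a = b.
Proof.
move=> [vE fE] ab; apply/matrixP => k j.
have tE i : tangent p (E i p) by have [] := vE i.
have [c [_ uc]] := fE _ (tangent_sum (index_enum _) (fun i => a i j) tE).
have ca : c = \row_i a i j by apply: uc; apply: eq_bigr => i _; rewrite mxE.
have cb : c = \row_i b i j.
  by apply: uc; rewrite ab; apply: eq_bigr => i _; rewrite mxE.
have /rowP/(_ k) : \row_i a i j = \row_i b i j :> 'rV_n by rewrite -ca.
by rewrite !mxE.
Qed.

Lemma sum_coef_mulmx (V : lmodType R) (e : 'I_n -> V) (a b : 'M[R]_n) j :
  \sum_i b i j *: (\sum_k a k i *: e k) = \sum_k (a *m b) k j *: e k.
Proof.
under eq_bigr do rewrite scaler_sumr.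
rewrite exchange_big /=; apply: eq_bigr => k _; rewrite mxE scaler_suml.
by apply: eq_bigr => i _; rewrite scalerA mulrC.
Qed.

Definition Cinf_linear A :=
  (forall X, vfield X -> vfield (A X)) /\
  forall u X X', smooth u -> vfield X -> vfield X' ->
    A (fscale u X + X') = fscale u (A X) + A X'.

Lemma Cinf_linear_sum A (I : Type) (r : seq I) (a : I -> M -> R)
    (X : I -> rawfield M) : Cinf_linear A ->
  (forall i, smooth (a i)) -> (forall i, vfield (X i)) ->
  A (\sum_(i <- r) fscale (a i) (X i)) = \sum_(i <- r) fscale (a i) (A (X i)).
Proof.
move=> [_ linA] sa vX; elim: r => [|i r IH].
  (* Linearity is available only in the form u X + X', so 0 is presented as (-1) 0 + 0 to get A 0 =
     0. *)
  have N0 (Z : rawfield M) : fscale (fun=> -1) Z + Z = 0.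
    by apply/funext => q; rewrite -[LHS]/(-1 *: Z q + Z q) scaleN1r addNr.
  rewrite !big_nil -[X in A X](N0 0) linA ?N0//; [|exact: vfield0..].
  exact: smooth_cst.
by rewrite !big_cons linA ?IH//; exact: vfield_sum.
Qed.

(* Multiplying Y by the determinant of [local_frame] writes it globally as a
   combination of the E i whose smooth coefficients vanish at p. *)
Lemma Cinf_linear_at0 A Y p : Cinf_linear A -> vfield Y -> Y p = 0 -> A Y p = 0.
Proof.
move=> linA vY Yp0.
have [E [w [vE sw Dp expand]]] := local_frame p.
set B := fun q : M => \matrix_(i, j) lie (E i) (w j) q in Dp expand.
pose c i q := ((\row_j Y q (w j)) *m \adj (B q)) 0 i.
have sB i j q : smooth_at (fun q => B q i j) q.
  apply: (@smooth_at_near_eq _ _ _ (lie (E i) (w j))).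
    by apply: filterE => q'; rewrite mxE.
  by apply: smooth_smooth_at; case: (vE i) => _; apply; exact: sw.
have sc i : smooth (c i).
  apply/smoothP => q; apply: (@smooth_at_near_eq _ _ _
      (fun q => \sum_j lie Y (w j) q * \adj (B q) j i)).
    by apply: filterE => q'; rewrite /c [RHS]mxE; apply: eq_bigr => j _;
      congr (_ * _); rewrite mxE.
  apply: smooth_at_sum => j _; apply: smooth_atM.
    by apply: smooth_smooth_at; case: vY => _; apply; exact: sw.
  by apply: smooth_at_adj => k l; exact: sB.
have sD : smooth (fun q => \det (B q)).
  by apply/smoothP => q; apply: smooth_at_det => i j; exact: sB.
have DY : fscale (fun q => \det (B q)) Y + 0 = \sum_i fscale (c i) (E i).
  rewrite addr0; apply/funext => q; rewrite /fscale expand; last by case: vY.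
  by rewrite fct_sumE.
have := congr1 (fun Z => A Z p) DY; rewrite /= Cinf_linear_sum//.
rewrite linA.2//; last exact: vfield0.
have A0 : A 0 = 0.
  by have := @Cinf_linear_sum A _ [::] c E linA sc vE; rewrite !big_nil.
rewrite A0 addr0 fct_sumE big1 => [|i _].
  by move/eqP; rewrite /fscale scaler_eq0 (negbTE Dp) => /eqP.
rewrite /fscale /c (_ : \row__ _ = 0) ?mul0mx ?mxE ?scale0r//.
by apply/rowP => j; rewrite !mxE Yp0.
Qed.

(** Y and the combination S of the X i with constant coefficients agree at p, perhaps only there;
    their difference vanishes at p, and so does its image under A. *)
Lemma Cinf_linear_at A (I : Type) (r : seq I) (a : I -> R)
    (X : I -> rawfield M) Y p : Cinf_linear A ->
  (forall i, vfield (X i)) -> vfield Y ->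
  Y p = \sum_(i <- r) a i *: X i p -> A Y p = \sum_(i <- r) a i *: A (X i) p.
Proof.
move=> linA vX vY Yp.
pose S := \sum_(i <- r) fscale (fun=> a i) (X i).
have sa i : smooth (fun _ : M => a i) by exact: smooth_cst.
have vS : vfield S by exact: vfield_sum.
have vYS : vfield (fscale (fun=> -1) S + Y).
  by apply: vfield_lin => //; exact: smooth_cst.
have Y0 : (fscale (fun=> -1) S + Y) p = 0.
  by rewrite -[LHS]/(-1 *: S p + Y p) Yp /S fct_sumE scaleN1r addNr.
have := Cinf_linear_at0 linA vYS Y0.
rewrite linA.2//; last exact: smooth_cst.
rewrite -[LHS]/(-1 *: A S p + A Y p) /S Cinf_linear_sum// fct_sumE scaleN1r.
by move/eqP; rewrite addrC subr_eq0 => /eqP.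
Qed.

(** [xget] returns the trace in some unknown frame. The two matrices of A are conjugate by the
    change of basis P at p (P a' = a P, P Q = 1), so their traces agree. *)
Lemma trace_atE A p E (a : 'M[R]_n) : Cinf_linear A -> frame_at p E ->
  (forall j, A (E j) p = \sum_i a i j *: E i p) -> trace_at A p = \tr a.
Proof.
move=> linA fE aE; rewrite /trace_at.
set S := (X in xget _ X).
have : S (xget 0 S) by apply: xgetPex; exists (\tr a), E, a.
move=> [E' [a' [fE' aE' ->]]].
have tE j : tangent p (E j p) by case: (fE.1 j).
have tE' j : tangent p (E' j p) by case: (fE'.1 j).
have [P EP] := frame_coef fE tE'.
have [Q EQ] := frame_coef fE' tE.
have PQ : P *m Q = 1%:M.
  apply: (frame_coef_inj fE) => j; rewrite -sum_coef_mulmx.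
  under eq_bigr do rewrite -EP.
  rewrite -EQ (bigD1 j)//= big1 => [|i ij].
    by rewrite mxE eqxx scale1r addr0.
  by rewrite mxE (negbTE ij) scale0r.
have PA : P *m a' = a *m P.
  apply: (frame_coef_inj fE) => j; rewrite -!sum_coef_mulmx.
  under eq_bigr do rewrite -EP.
  under [RHS]eq_bigr do rewrite -aE.
  (* The fields E' j are combinations of the E i at p only; pointwise dependence of A is essential
     here. *)
  rewrite -aE'; apply: Cinf_linear_at => //; [exact: fE.1|exact: fE'.1].
rewrite -[a']mul1mx -(mulmx1C PQ) -mulmxA PA mulmxA mxtrace_mulC.
by rewrite mulmxA PQ mul1mx.
Qed.

Lemma smooth_trace_at A : Cinf_linear A -> smooth (trace_at A).
Proof.
move=> linA; apply/smoothP => p.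
have [E [w [vE sw Dp expand]]] := local_frame p.
set B := fun q : M => \matrix_(i, j) lie (E i) (w j) q in Dp expand.
have sB i j q : smooth_at (fun q => B q i j) q.
  apply: (@smooth_at_near_eq _ _ _ (lie (E i) (w j))).
    by apply: filterE => q'; rewrite mxE.
  by apply: smooth_smooth_at; case: (vE i) => _; apply; exact: sw.
have sD q : smooth_at (fun q => \det (B q)) q.
  by apply: smooth_at_det => i j; exact: sB.
have invB q : \det (B q) != 0 -> invmx (B q) = (\det (B q))^-1 *: \adj (B q).
  by move=> Dq; rewrite /invmx unitmxE unitfE Dq.
have coef q v : \det (B q) != 0 -> tangent q v ->
    v = \sum_i ((\row_j v (w j)) *m invmx (B q)) 0 i *: E i q.
  move=> Dq tv; apply: (scalerI Dq); rewrite expand// scaler_sumr.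
  apply: eq_bigr => i _; rewrite invB// -scalemxAr [in RHS]mxE !scalerA mulrA.
  by rewrite mulfV// mul1r.
have frameE q : \det (B q) != 0 -> frame_at q E.
  move=> Dq; split=> // v tv; exists ((\row_j v (w j)) *m invmx (B q)).
  split; first exact: coef.
  move=> a va; rewrite (_ : \row__ _ = a *m B q).
    by rewrite mulmxK// unitmxE unitfE.
  apply/rowP => j; rewrite !mxE va fct_sumE; apply: eq_bigr => i _.
  by rewrite fctE !mxE.
pose L q : 'M[R]_n := \matrix_(i, j) lie (A (E i)) (w j) q.
have sL i j q : smooth_at (lie (A (E i)) (w j)) q.
  apply: smooth_smooth_at.
  by have [_] := linA.1 _ (vE i); apply; exact: sw.
apply: (@smooth_at_near_eq _ _ _ (fun q => (\det (B q))^-1 *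
    \sum_i \sum_j lie (A (E i)) (w j) q * \adj (B q) j i)).
  apply: filterS (smooth_at_neq0 (sD p) Dp) => q Dq.
  (* Row i of L B^-1 holds the coefficients of A (E i), whereas [trace_at] stores them in columns;
     hence the transpose. *)
  rewrite (@trace_atE A q E (L q *m invmx (B q))^T) ?mxtrace_tr//.
  - rewrite invB// -scalemxAr mxtraceZ; congr (_ * _); apply: eq_bigr => i _.
    by rewrite mxE; apply: eq_bigr => j _; congr (_ * _); rewrite mxE.
  - exact: frameE.
  - move=> j; rewrite [LHS](coef q)//; last by case: (linA.1 _ (vE j)).
    apply: eq_bigr => i _; congr (_ *: _); rewrite !mxE.
    by apply: eq_bigr => k _; congr (_ * _); rewrite !mxE.
apply: smooth_atM; first exact: smooth_atV.
apply: smooth_at_sum => i _; apply: smooth_at_sum => j _.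
by apply: smooth_atM; [exact: sL|apply: smooth_at_adj => k l; exact: sB].
Qed.

(* Only 0-dimensional manifolds have points where every vector field vanishes;
   there every function is smooth. *)
Lemma smooth_or_vfield_neq0 p :
  (forall u : M -> R, smooth_at u p) \/ exists2 X, vfield X & X p <> 0.
Proof.
have [n0|n0] := posnP n.
  left=> u; have [c ac cp] := atlas_cover p; exists c; split=> //.
  have noI : 'I_n -> False by rewrite n0 => -[].
  move=> k; apply: (@Ck_near_ext _ _ _ (fun=> u p)); last exact: Ck_near_cst.
  move=> x; rewrite -[in LHS](chart_mapKp cp); congr (u (chart_inv c _)).
  by apply/rowP => i; case: (noI i).
right; have [E [w [vE _ Dp _]]] := local_frame p.
exists (E (Ordinal n0)) => // E0; move/eqP: Dp; apply.
rewrite (expand_det_row _ (Ordinal n0)) big1// => j _.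
by rewrite mxE /lie E0 mul0r.
Qed.

End Frames.

(** * Connections and solitons *)

Section Connections.
Variables (R : realType) (n : nat) (M : manifold R n).
Implicit Types (p q : M) (X Y Z : rawfield M) (u : M -> R).

Lemma rawfield_ext X Y : (forall p u, X p u = Y p u) -> X = Y.
Proof. by move=> XY; apply/funext => p; apply/funext => u. Qed.

Lemma rawfieldD X Y p u : (X + Y) p u = X p u + Y p u. Proof. by []. Qed.

Lemma rawfieldN X p u : (- X) p u = - X p u. Proof. by []. Qed.

Lemma fscaleE (h : M -> R) X p u : fscale h X p u = h p * X p u.
Proof. by []. Qed.

Definition rawfieldE := (rawfieldD, rawfieldN, fscaleE).

Lemma fscaleN1D X Y : fscale (fun=> -1) X + Y = Y - X.
Proof. by apply: rawfield_ext => p u; rewrite !rawfieldE; ring. Qed.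

Lemma vfieldB X Y : vfield X -> vfield Y -> vfield (X - Y).
Proof.
move=> vX vY; rewrite -fscaleN1D.
by apply: vfield_lin => //; exact: smooth_cst.
Qed.

Section Tensor2.
Variables (h : rawtensor2 M) (hh : tensor2 h).

Lemma tensor2_smooth X Y : vfield X -> vfield Y -> smooth (h X Y).
Proof. by case: hh => + _ _; apply. Qed.

Lemma tensor2Bl X X' Y p : vfield X -> vfield X' -> vfield Y ->
  h (X - X') Y p = h X Y p - h X' Y p.
Proof.
move=> vX vX' vY; case: hh => _ + _; rewrite -fscaleN1D => ->//.
  by ring.
exact: smooth_cst.
Qed.

Lemma tensor20l Y p : vfield Y -> h 0 Y p = 0.
Proof.
move=> vY; rewrite -[X in h X Y](subrr (0 : rawfield M)).
rewrite tensor2Bl ?subrr//; exact: vfield0.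
Qed.

End Tensor2.

(** * Tensoriality of the curvature and smoothness of the Ricci tensor *)

Section Connection.
Variables (nabla : rawconnection M).
Hypotheses (aff : affine_connection nabla) (tors : torsion_free nabla).

Lemma vfield_nabla X Y : vfield X -> vfield Y -> vfield (nabla X Y).
Proof. by case: aff => + _ _ _; apply. Qed.

Lemma vfield_bracket X Y : vfield X -> vfield Y -> vfield (bracket X Y).
Proof. by move=> vX vY; rewrite -tors//; apply: vfieldB; exact: vfield_nabla. Qed.

Lemma nablaBl X X' Y : vfield X -> vfield X' -> vfield Y ->
  nabla (X - X') Y = nabla X Y - nabla X' Y.
Proof.
move=> vX vX' vY; case: aff => _ + _ _; rewrite -fscaleN1D => ->//.
  exact: fscaleN1D.
exact: smooth_cst.
Qed.

Lemma nabla0r X : vfield X -> nabla X 0 = 0.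
Proof.
move=> vX; case: aff => _ _ addr _; have v0 := vfield0 M.
by have /eqP := addr X 0 0 vX v0 v0; rewrite addr0 -subr_eq0 opprD addrA subrr
  sub0r oppr_eq0 => /eqP.
Qed.

Lemma vfield_curvature X Y Z : vfield X -> vfield Y -> vfield Z ->
  vfield (curvature nabla X Y Z).
Proof.
move=> vX vY vZ; have vn := vfield_nabla.
apply: vfieldB; last by apply: (vn) => //; exact: vfield_bracket.
by apply: vfieldB; apply: (vn) => //; exact: (vn).
Qed.

(** The derivative of u produced by nabla_Y (u nabla_X Z) cancels against the term -Y(u) X of the
    bracket [u X, Y]. *)
Lemma curvature_linear Y Z : vfield Y -> vfield Z ->
  Cinf_linear (fun X => curvature nabla X Y Z).
Proof.
move=> vY vZ; split=> [X vX|u X X' su vX vX']; first exact: vfield_curvature.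
have vn := vfield_nabla; have [_ linl addr leib] := aff.
have vuX : vfield (fscale u X).
  by rewrite -[fscale u X]addr0; apply: vfield_lin => //; exact: vfield0.
have vunX : vfield (fscale u (nabla X Z)).
  rewrite -[fscale u _]addr0; apply: vfield_lin => //; last exact: vfield0.
  exact: (vn).
have sYu : smooth (lie Y u) by case: vY => _; apply.
have vB : vfield (fscale (fun q => - lie Y u q) X + bracket X' Y).
  by apply: vfield_lin => //; [exact: smoothN|exact: vfield_bracket].
(* Torsion-freeness turns the brackets into covariant derivatives, so this Leibniz rule follows from
   that of the connection. *)
have brE : bracket (fscale u X + X') Y =
    fscale u (bracket X Y) + (fscale (fun q => - lie Y u q) X + bracket X' Y).
  rewrite -!tors//; last exact: vfield_lin.
  rewrite linl// addr// leib//.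
  by apply: rawfield_ext => p w; rewrite !rawfieldE; ring.
rewrite /curvature brE linl//; last exact: (vn).
rewrite linl// [nabla Y (_ + _)]addr//; last exact: (vn).
rewrite leib//; last exact: (vn).
rewrite linl//; last exact: vfield_bracket.
rewrite linl//; [|exact: smoothN|exact: vfield_bracket].
by apply: rawfield_ext => p w; rewrite !rawfieldE; ring.
Qed.

Lemma smooth_ricci Y Z : vfield Y -> vfield Z -> smooth (ricci nabla Y Z).
Proof. by move=> vY vZ; apply: smooth_trace_at; exact: curvature_linear. Qed.

End Connection.

(** * The gradient and the symmetry of the Hessian *)

Section Gradient.
Variables (g : rawtensor2 M) (f : M -> R).

(* No gradient needs to exist: the default value 0 of [xget] is also a vector
   field, and its Hessian is zero, hence symmetric. *)
Lemma gradP : grad g f = 0 \/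
  vfield (grad g f) /\ forall X, vfield X -> g (grad g f) X = lie X f.
Proof.
rewrite /grad; case: xgetP => [G _ [vG GE]|_]; last by left.
by right; split=> // X vX; apply/funext => p; exact: GE.
Qed.

Lemma vfield_grad : vfield (grad g f).
Proof. by case: gradP => [->|[]//]; exact: vfield0. Qed.

(** For an actual gradient, Hess(f)(X, Y) = X(Y f) - (nabla_X Y) f because g is parallel; its
    antisymmetric part is [X, Y] f - (nabla_X Y - nabla_Y X) f, which is 0 without torsion. *)
Lemma hess_sym nabla : tensor2 g -> levi_civita g nabla ->
  symmetric2 (hess g nabla f).
Proof.
move=> tg [aff tors comp] X Y vX vY p; rewrite /hess.
have vn := vfield_nabla aff.
case: gradP => [->|[vG GE]]; first by rewrite !nabla0r// !tensor20l.
have E Z W : vfield Z -> vfield W -> g (nabla Z (grad g f)) W p =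
    lie Z (lie W f) p - lie (nabla Z W) f p.
  move=> vZ vW; have := comp _ _ _ vZ vG vW p.
  rewrite /covder GE// [g _ (nabla Z W)]GE; last exact: vn.
  by move=> H; lra.
have := congr1 (fun W : rawfield M => W p f) (tors X Y vX vY).
rewrite /= /bracket !rawfieldE !E// /lie => H; lra.
Qed.

End Gradient.

(** * Consequences of the soliton equation *)

Section Soliton.
Variables (g : rawtensor2 M) (nabla : rawconnection M) (f lam : M -> R).
Hypotheses (hg : pseudo_riemannian g) (lc : levi_civita g nabla).
Hypothesis sol : gradient_almost_einstein_soliton g nabla f lam.

Let G := grad g f.
Let mu : M -> R := fun q => lam q + scal g nabla q / 2.

Let tg : tensor2 g. Proof. by case: hg. Qed.
Let aff : affine_connection nabla. Proof. by case: lc. Qed.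
Let tors : torsion_free nabla. Proof. by case: lc. Qed.
Let vG : vfield G. Proof. exact: vfield_grad. Qed.
Let vn X Y : vfield X -> vfield Y -> vfield (nabla X Y).
Proof. exact: vfield_nabla. Qed.

(** An equality of functions, since it is rewritten under a derivation; the shape [_ + - _] is the
    one that [tangentD] and [tangentN] consume. *)
Lemma soliton_ricciE X Y : vfield X -> vfield Y ->
  ricci nabla X Y = fun q => mu q * g X Y q + - g (nabla X G) Y q.
Proof.
move=> vX vY; apply/funext => q; rewrite -sol// /hess -/G.
by ring.
Qed.

Lemma soliton_ricci_tensor2 : tensor2 (ricci nabla).
Proof.
have [_ gl gr] := tg; have [_ linl _ _] := aff; split.
- by move=> X Y vX vY; exact: smooth_ricci.
- move=> u X X' Y su vX vX' vY p.
  have vXX := vfield_lin su vX vX'.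
  rewrite !soliton_ricciE// linl// !gl//; [|exact: vn..].
  by ring.
- move=> u X Y Y' su vX vY vY' p.
  have vYY := vfield_lin su vY vY'.
  rewrite !soliton_ricciE// !gr//; last exact: vn.
  by ring.
Qed.

Lemma soliton_ricci_sym : symmetric2 (ricci nabla).
Proof.
move=> X Y vX vY p; rewrite !soliton_ricciE//.
have [_ gs _] := hg; have := hess_sym f tg lc vX vY p.
by rewrite /hess -/G => ->; rewrite (gs X Y vX vY).
Qed.

(* Near p this is (Ric + Hess)(X, Y) / g(X, Y), which avoids analysing scal.
   Smoothness matters because tangent vectors vanish on non-smooth functions. *)
Lemma soliton_coef_smooth : smooth mu.
Proof.
apply/smoothP => p; have [//|[X vX Xp0]] := smooth_or_vfield_neq0 p.
have [Y vY gp0] : exists2 Y, vfield Y & g X Y p != 0.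
  apply: contrapT => nY; apply: Xp0; have [_ _ nd] := hg.
  apply: nd => // Y vY; apply/eqP; apply: contrapT => /negP gXY.
  by apply: nY; exists Y.
have sg : smooth_at (g X Y) p.
  by apply: smooth_smooth_at; exact: tensor2_smooth.
apply: (@smooth_at_near_eq _ _ _ (fun q =>
    (ricci nabla X Y q + g (nabla X G) Y q) * (g X Y q)^-1)).
  apply: filterS (smooth_at_neq0 sg gp0) => q gq0.
  by rewrite soliton_ricciE// subrK mulfK.
apply: smooth_atM; last exact: smooth_atV.
apply: smooth_atD; apply: smooth_smooth_at; first exact: smooth_ricci.
exact: (tensor2_smooth tg (vn vX vG) vY).
Qed.

Lemma levi_civita_lie X Y Z p : vfield X -> vfield Y -> vfield Z ->
  lie X (g Y Z) p = g (nabla X Y) Z p + g Y (nabla X Z) p.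
Proof.
move=> vX vY vZ; have [_ _ /(_ _ _ _ vX vY vZ p)] := lc.
by rewrite /covder => /eqP; rewrite subr_eq0 subr_eq addrC => /eqP.
Qed.

(** The terms in which mu is not differentiated cancel because g is parallel; the Hessian
    contributes the second covariant derivative of the gradient, nabla_X nabla_Y G - nabla_(nabla_X
    Y) G, paired with Z. *)
Lemma soliton_covder X Y Z p : vfield X -> vfield Y -> vfield Z ->
  covder nabla (ricci nabla) X Y Z p =
  lie X mu p * g Y Z p
  - (g (nabla X (nabla Y G)) Z p - g (nabla (nabla X Y) G) Z p).
Proof.
move=> vX vY vZ; have smu := soliton_coef_smooth.
have [tX _] := vX.
have sg : smooth (g Y Z) := tensor2_smooth tg vY vZ.
have sh : smooth (g (nabla Y G) Z) := tensor2_smooth tg (vn vY vG) vZ.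
rewrite /covder !soliton_ricciE//; [|exact: vn..].
rewrite /lie (tangentD (tX p))//; [|exact: smoothM|exact: smoothN].
rewrite (tangentM (tX p))// (tangentN (tX p))//.
rewrite -![X p (g _ _)]/(lie X (g _ _) p) !levi_civita_lie//; last exact: vn.
by ring.
Qed.

(** The Ricci identity: without torsion, antisymmetrising the second covariant derivative of G in X
    and Y leaves R(X, Y) G. *)
Lemma soliton_covder_alt X Y Z p : vfield X -> vfield Y -> vfield Z ->
  covder nabla (ricci nabla) X Y Z p - covder nabla (ricci nabla) Y X Z p =
  lie X mu p * g Y Z p - lie Y mu p * g X Z p - g (curvature nabla X Y G) Z p.
Proof.
move=> vX vY vZ; rewrite !soliton_covder// /curvature -tors//.
have vXY := vn vX vY; have vYX := vn vY vX.
have vXYG := vn vX (vn vY vG); have vYXG := vn vY (vn vX vG).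
rewrite (nablaBl aff vXY vYX vG).
rewrite (tensor2Bl tg p (vfieldB vXYG vYXG) (vfieldB (vn vXY vG) (vn vYX vG)) vZ).
rewrite (tensor2Bl tg p vXYG vYXG vZ) (tensor2Bl tg p (vn vXY vG) (vn vYX vG) vZ).
by ring.
Qed.

End Soliton.
End Connections.

Theorem proposition2p4 (R : realType) (n : nat) (M : manifold R n)
    (g : rawtensor2 M) (nabla : rawconnection M) (f lam : M -> R)
    (hg : pseudo_riemannian g)
    (hnabla : levi_civita g nabla)
    (hRic : nondegenerate2 (ricci nabla))
    (hf : smooth f) (hlam : smooth lam)
    (hsol : gradient_almost_einstein_soliton g nabla f lam) :
  statistical_structure (ricci nabla) nabla <->
  (forall X Y Z : rawfield M, vfield X -> vfield Y -> vfield Z ->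
   forall p : M,
     g (curvature nabla X Y (grad g f)) Z p =
     lie X (fun q => lam q + scal g nabla q / 2) p * g Y Z p -
     lie Y (fun q => lam q + scal g nabla q / 2) p * g X Z p).
Proof.
have alt := soliton_covder_alt hg hnabla hsol; split.
  move=> [_ _ _ codazzi] X Y Z vX vY vZ p; apply/esym/eqP.
  by rewrite -subr_eq0 -alt// codazzi// subrr.
move=> curvE; have [aff tors _] := hnabla; split=> //.
  split=> //; first exact: soliton_ricci_tensor2 hg hnabla hsol.
  exact: soliton_ricci_sym hg hnabla hsol.
move=> X Y Z vX vY vZ p; apply/eqP.
by rewrite -subr_eq0 alt// curvE// subrr.
Qed.
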